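(* Let $k:\mathbb{D}\times\mathbb{D}\to\mathbb{C}$ be an analytic kernel with $\mathbb{C}[z]\subseteq\mathcal{H}_k$, and let $\{f_n\}_{n\ge 0}\subseteq\mathbb{C}[z]$ be an orthonormal basis of $\mathcal{H}_k$. Assume that the shift $M_z$ on $\mathcal{H}_k$ is left-invertible, $\ker M_z^*=\mathbb{C}f_0$, and $f_n\in\operatorname{span}\{z^m:m\ge 1\}$ for all $n\ge 1$. Put $$Fg=\langle g,f_0\rangle_{\mathcal{H}_k}\,(M_z^*|M_z|M_z)^{-1}M_z^*|M_z|f_0\quad(g\in\mathcal{H}_k),\qquad L=|M_z|^{1/2}(L_{M_z}+F)|M_z|^{-1/2},$$ $\mathcal{W}=|M_z|^{-1/2}\ker M_z^*=\mathbb{C}(|M_z|^{-1/2}f_0)$, and $\Omega=\{z\in\mathbb{C}:|z|<1/r(L)\}$, with $r(L)$ the spectral radius of $L$. Then the Aluthge transform $\tilde M_z$ of $M_z$ on $\mathcal{H}_k$ is unitarily equivalent to the shift $M_z$ on $\mathcal{H}_{\tilde k}$, where $$\tilde k(z,w)=P_{\mathcal{W}}(I-zL)^{-1}(I-\bar wL^* )^{-1}|_{\mathcal{W}}\qquad(z,w\in\Omega),$$ and $P_{\mathcal{W}}$ is the orthogonal projection of $\mathcal{H}_k$ onto $\mathcal{W}$.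
   Context: $\mathbb{D}$ is the open unit disc. A scalar (or $\mathcal{B}(\mathcal{W})$-valued) analytic kernel is a positive definite kernel analytic in the first variable; $\mathcal{H}_k$ is its reproducing kernel Hilbert space of analytic (respectively $\mathcal{W}$-valued analytic) functions; the shift is $(M_zf)(w)=wf(w)$, assumed to be bounded on $\mathcal{H}_k$. For a bounded operator $T$ on a Hilbert space: $|T|=(T^*T)^{1/2}$; $T=U|T|$ is the polar decomposition with $U$ the unique partial isometry with $\ker U=\ker T$; the Aluthge transform is $\tilde T=|T|^{1/2}U|T|^{1/2}$. $T$ is left-invertible if $XT=I$ for some bounded $X$ (equivalently $T^*T$ is invertible); then its Shimorin left inverse is $L_T=(T^*T)^{-1}T^*$. *)

(* Defs.v *)
From HB Require Import structures.
From mathcomp Require Import all_boot all_order all_algebra.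
From mathcomp Require Import sesquilinear complex.
From mathcomp Require Import all_classical all_reals all_analysis.

Set Implicit Arguments.
Unset Strict Implicit.
Unset Printing Implicit Defensive.

Import Order.TTheory GRing.Theory Num.Theory.
Import numFieldNormedType.Exports.

Local Open Scope classical_set_scope.
Local Open Scope ring_scope.

(* The inner product is linear in its first argument; norms over the field
   R[i] take their values in R[i] and are nonnegative there. *)
HB.mixin Record isHilbert (R : realType) (H : Type)
    & CompleteNormedModule R[i] H := {
  hdot : {dot H for (@Num.conj R[i])} ;
  hdot_norm : forall x : H, `|x| ^+ 2 = hdot x x
}.

#[short(type="hilbertType")]
HB.structure Definition Hilbert (R : realType) :=
  {H of isHilbert R H & CompleteNormedModule R[i] H}.

Section Operators.
Variable R : realType.
Local Notation C := R[i].
Implicit Types H K : hilbertType R.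

Definition bounded_op H K (T : H -> K) : Prop :=
  linear T /\ exists c : C, forall x, `|T x| <= c * `|x|.

(* The operators below are chosen by their defining property (0 if there is
   none); whenever they exist they are unique. *)

Definition adjoint H (T : H -> H) : H -> H :=
  xget (fun=> 0) [set S | bounded_op S /\
                          forall x y, hdot (T x) y = hdot x (S y)].

Definition is_inverse H (T S : H -> H) : Prop :=
  [/\ bounded_op S, S \o T = id & T \o S = id].

Definition op_inv H (T : H -> H) : H -> H :=
  xget (fun=> 0) [set S | is_inverse T S].

Definition positive_op H (T : H -> H) : Prop :=
  bounded_op T /\ forall x, 0 <= hdot (T x) x.

Definition op_sqrt H (T : H -> H) : H -> H :=
  xget (fun=> 0) [set S | positive_op S /\ S \o S = T].

Definition op_abs H (T : H -> H) : H -> H := op_sqrt (adjoint T \o T).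

Definition op_ker H K (T : H -> K) : set H := [set x | T x = 0].

Definition ortho_compl H (A : set H) : set H :=
  [set x | forall y, A y -> hdot x y = 0].

Definition partial_isometry H (U : H -> H) : Prop :=
  bounded_op U /\ forall x, ortho_compl (op_ker U) x -> `|U x| = `|x|.

Definition polar_isometry H (T : H -> H) : H -> H :=
  xget (fun=> 0) [set U | [/\ partial_isometry U, T = U \o op_abs T &
                              op_ker U = op_ker T]].

Definition aluthge H (T : H -> H) : H -> H :=
  op_sqrt (op_abs T) \o polar_isometry T \o op_sqrt (op_abs T).

Definition left_invertible H (T : H -> H) : Prop :=
  exists X : H -> H, bounded_op X /\ X \o T = id.

Definition shimorin_inv H (T : H -> H) : H -> H :=
  op_inv (adjoint T \o T) \o adjoint T.

Definition spectrum H (T : H -> H) : set C :=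
  [set l | ~ exists S, is_inverse (fun x => l *: x - T x) S].

Definition spectral_radius H (T : H -> H) : R :=
  sup [set complex.Re `|l| | l in spectrum T].

(* Orthogonal projection onto a closed subspace. *)
Definition oproj H (W : set H) (x : H) : H :=
  xget 0 [set p | W p /\ ortho_compl W (x - p)].

Definition lin_span H (A : set H) : set H :=
  [set x | exists n (c : 'I_n -> C) (v : 'I_n -> H),
     (forall i, A (v i)) /\ x = \sum_i c i *: v i].

Definition orthonormal_basis H (f : nat -> H) : Prop :=
  (forall n m, hdot (f n) (f m) = (n == m)%:R) /\
  closure (lin_span (range f)) = [set: H].

Definition unitarily_equivalent H K (A : H -> H) (B : K -> K) : Prop :=
  exists U : H -> K,
    [/\ linear U, forall x y, hdot (U x) (U y) = hdot x y,
        forall y, exists x, U x = y & U \o A = B \o U].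

End Operators.

Section FunctionSpaces.
Variable R : realType.
Local Notation C := R[i].

Definition unit_disc : set C := [set z | `|z| < 1].

(* Local power series expansions; X is open as soon as something is analytic
   on it. *)
Definition analytic_on (E : normedModType C) (X : set C) (f : C -> E) : Prop :=
  forall a, X a -> exists (c : nat -> E) (r : C), 0 < r /\
    forall z, `|z - a| < r ->
      X z /\ (\sum_(i < n) (z - a) ^+ i *: c i) @[n --> \oo] --> f z.

(* A Hilbert space H of analytic functions on X is given by an evaluation map
   ev: f in H is the function z |-> ev f z on X. Values of ev f outside X are
   irrelevant. *)
Definition analytic_function_space (E : normedModType C) (X : set C)
    (H : hilbertType R) (ev : H -> C -> E) : Prop :=
  [/\ forall a f g z, X z -> ev (a *: f + g) z = a *: ev f z + ev g z,
      forall f, (forall z, X z -> ev f z = 0) -> f = 0 &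
      forall f, analytic_on X (ev f)].

Definition is_shift (E : normedModType C) (X : set C)
    (H : hilbertType R) (ev : H -> C -> E) (M : H -> H) : Prop :=
  bounded_op M /\ forall f z, X z -> ev (M f) z = z *: ev f z.

Definition analytic_kernel (X : set C) (k : C -> C -> C) : Prop :=
  (forall n (z c : 'I_n -> C), (forall i, X (z i)) ->
     0 <= \sum_i \sum_j (c i)^* * k (z i) (z j) * c j) /\
  (forall w, X w -> analytic_on (E := C^o) X (k^~ w)).

Definition is_rkhs (X : set C) (k : C -> C -> C)
    (H : hilbertType R) (ev : H -> C -> C^o) : Prop :=
  analytic_function_space X ev /\
  forall w, X w -> exists kw : H,
    (forall z, X z -> ev kw z = k z w) /\ (forall f, ev f w = hdot f kw).

(* The coefficient space is a closed subspace W of a Hilbert space E; an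
   operator on W is given by a map of E of which only the restriction to W
   matters. *)
Definition analytic_op_kernel (E : hilbertType R) (W : set E) (X : set C)
    (k : C -> C -> E -> E) : Prop :=
  [/\ forall z w, X z -> X w ->
        [/\ forall x, W x -> W (k z w x),
            forall a x y, W x -> W y ->
              k z w (a *: x + y) = a *: k z w x + k z w y &
            exists c : C, forall x, W x -> `|k z w x| <= c * `|x|],
      forall n (z : 'I_n -> C) (x : 'I_n -> E),
        (forall i, X (z i)) -> (forall i, W (x i)) ->
        0 <= \sum_i \sum_j hdot (k (z i) (z j) (x j)) (x i) &
      forall w x, X w -> W x -> analytic_on X (fun z => k z w x)].

Definition is_op_rkhs (E : hilbertType R) (W : set E) (X : set C)
    (k : C -> C -> E -> E) (H : hilbertType R) (ev : H -> C -> E) : Prop :=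
  [/\ analytic_function_space X ev,
      forall f z, X z -> W (ev f z) &
      forall w x, X w -> W x -> exists kwx : H,
        (forall z, X z -> ev kwx z = k z w x) /\
        (forall f, hdot (ev f w) x = hdot f kwx)].

End FunctionSpaces.

Arguments unit_disc {R}.

(* Main.v *)
Require Import Defs.
From HB Require Import structures.
From mathcomp Require Import all_boot all_order all_algebra.
From mathcomp Require Import sesquilinear complex ring lra.
From mathcomp Require Import all_classical all_reals all_analysis.

Set Implicit Arguments.
Unset Strict Implicit.
Unset Printing Implicit Defensive.

Import Order.TTheory GRing.Theory Num.Theory.
Import numFieldNormedType.Exports.

Local Open Scope classical_set_scope.
Local Open Scope ring_scope.

(** Write [A = |M|] and [h] for its square root, both invertible because [M] is
    left-invertible. Then the polar isometry is [M A ^-1], and the Aluthge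
    transform is [T = h M h ^-1]: it is similar to [M] ([aluthgeE]).

    The operator [L] is the Shimorin left inverse of [T]. Indeed that inverse is
    [h G h ^-1] with [G = (M^* A M) ^-1 M^* A], and [G] equals [L_M + F]: both are
    left inverses of [M], and on the complement [ker M^* = C f0] of the range
    of [M] the first summand vanishes while [F f0 = G f0]
    ([shimorin_rank_one]). Consequently [1 - T L] is the orthogonal projection
    onto the complement of the range of [T], which is [W = h ^-1 ker M^*]
    ([aluthge_range_ortho], [aluthge_defect]).

    A function in the ranges of all powers of [M] vanishes at 0 to infinite
    order, hence everywhere on the disc ([shift_pure], by
    [identity_theorem_disc]); by similarity the ranges of the powers of [T]
    meet in 0 only.

    Such a pure left-invertible [T] is modelled by the functions
    [z |-> P (1 - z L) ^-1 x] with [P = oproj W]. They satisfy [P T = 0] and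
    [(1 - z L) ^-1 T = T + z (1 - z L) ^-1], so that [T] becomes multiplication
    by [z] ([model_eval_shift]). If the function of [x] vanishes identically,
    its Taylor coefficients [P (L ^ n x)] are 0, so [x = T ^ n (L ^ n x)] for
    all [n], and [x = 0] by purity ([model_eval_inj]). Moving the operators to
    the other side of the inner product shows that the reproducing kernel is
    the required one ([model_eval_dot]); hence the given Hilbert space, with
    this evaluation map, is already a space with that kernel ([model_rkhs]).
    Any other such space has total kernel functions with the same Gram matrix,
    and is therefore unitarily equivalent to it ([model_unitary]).

    On the disc of radius [1 / r(L)] the resolvent exists because [1 / z] avoids
    the spectrum ([resolvent_exists]), and it is analytic by Neumann series
    ([resolvent_expansion]). The Hilbert space theory used here rests on the
    projection onto subspaces ([projection]), which gives adjoints, and on the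
    contraction [1 - t A] attached to a coercive operator [A]
    ([coercive_contraction]), which gives inverses and square roots. *)

(** * Real-valued norms and moduli *)

Lemma eq_cvg_seq (E : topologicalType) (u v : nat -> E) (l : E) :
  u =1 v -> u n @[n --> \oo] --> l -> v n @[n --> \oo] --> l.
Proof. by move=> /funext->. Qed.

Section RealNorm.
Variable R : realType.
Local Notation C := R[i].
Local Open Scope complex_scope.

(** Norms over [R[i]] take their values in [R[i]], whose order is partial;
    estimates are made on their real parts. *)
Definition cabs (z : C) : R := complex.Re `|z|.

Definition nrm (E : normedModType C) (x : E) : R := complex.Re `|x|.

Lemma ge0_ReK (a : C) : 0 <= a -> a = (complex.Re a)%:C.
Proof. by case: a => a b; rewrite lecE /= => /andP[/eqP-> _]. Qed.

Lemma cabsE (z : C) : `|z| = (cabs z)%:C.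
Proof. exact/ge0_ReK/normr_ge0. Qed.

Lemma cabs_ge0 z : 0 <= cabs z.
Proof. by rewrite -lecR -cabsE normr_ge0. Qed.

Lemma cabsM z w : cabs (z * w) = cabs z * cabs w.
Proof. by apply: (@complexI R); rewrite -cabsE normrM !cabsE rmorphM. Qed.

Lemma cabsD z w : cabs (z + w) <= cabs z + cabs w.
Proof. by rewrite -lecR rmorphD /= -!cabsE ler_normD. Qed.

Lemma cabs0 : cabs 0 = 0. Proof. by rewrite /cabs normr0. Qed.

Lemma cabs1 : cabs 1 = 1. Proof. by rewrite /cabs normr1. Qed.

Lemma cabs_eq0 z : cabs z = 0 -> z = 0.
Proof. by move=> z0; apply/eqP; rewrite -normr_eq0 cabsE z0. Qed.

Lemma cabs_gt0 z : z != 0 -> 0 < cabs z.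
Proof.
by move=> z0; rewrite lt_neqAle cabs_ge0 andbT eq_sym;
  apply: contra z0 => /eqP/cabs_eq0->.
Qed.

Lemma cabsX z n : cabs (z ^+ n) = cabs z ^+ n.
Proof. by elim: n => [|n IH]; rewrite ?expr0 ?cabs1 // !exprS cabsM IH. Qed.

Lemma cabsV z : cabs z^-1 = (cabs z)^-1.
Proof. by apply: (@complexI R); rewrite -cabsE normfV cabsE fmorphV. Qed.

Lemma cabs_real (t : R) : cabs t%:C = `|t|.
Proof. by rewrite /cabs normc_def /= expr0n addr0 sqrtr_sqr. Qed.

Section Normed.
Variable E : normedModType C.
Implicit Types (x y : E) (u : nat -> E).

Lemma nrmE x : `|x| = (nrm x)%:C.
Proof. exact/ge0_ReK/normr_ge0. Qed.

Lemma nrm_ge0 x : 0 <= nrm x.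
Proof. by rewrite -lecR -nrmE normr_ge0. Qed.

Lemma nrm0 : nrm (0 : E) = 0. Proof. by rewrite /nrm normr0. Qed.

Lemma nrm_eq0 x : nrm x = 0 -> x = 0.
Proof. by move=> x0; apply/eqP; rewrite -normr_eq0 nrmE x0. Qed.

Lemma nrmD x y : nrm (x + y) <= nrm x + nrm y.
Proof. by rewrite -lecR rmorphD /= -!nrmE ler_normD. Qed.

Lemma nrmN x : nrm (- x) = nrm x. Proof. by rewrite /nrm normrN. Qed.

Lemma nrmBC x y : nrm (x - y) = nrm (y - x).
Proof. by rewrite /nrm distrC. Qed.

Lemma nrm_tri x y z : nrm (x - z) <= nrm (x - y) + nrm (y - z).
Proof. by rewrite -{1}(subrK y x) -addrA nrmD. Qed.

Lemma nrmZ a x : nrm (a *: x) = cabs a * nrm x.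
Proof. by apply: (@complexI R); rewrite -nrmE normrZ cabsE nrmE rmorphM. Qed.

Lemma nrm_small x : (forall e, 0 < e -> nrm x <= e) -> x = 0.
Proof.
move=> x0; apply: nrm_eq0; apply/eqP; rewrite eq_le nrm_ge0 andbT.
by apply/ler_addgt0Pl => e /x0; rewrite addr0.
Qed.

Lemma cvg_nrmP u x : u n @[n --> \oo] --> x <->
  (forall e : R, 0 < e -> exists N, forall n, (N <= n)%N -> nrm (u n - x) < e).
Proof.
split=> [/cvgrPdist_lt ux e e0|ux].
  have /ux[N _ uN] : 0 < e%:C by rewrite ltcR.
  by exists N => n /uN /=; rewrite nrmE ltcR nrmBC.
apply/cvgrPdist_lt => e e0; have /ux[N uN] : 0 < complex.Re e.
  by rewrite -ltcR -ge0_ReK // ltW.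
exists N => // n /= /uN; rewrite -ltcR -nrmE -ge0_ReK ?ltW // => h.
by rewrite distrC.
Qed.

Lemma cvg_nrm_le u x (c : R) (y : E) (N : nat) : u n @[n --> \oo] --> x ->
  (forall n, (N <= n)%N -> nrm (u n - y) <= c) -> nrm (x - y) <= c.
Proof.
move=> /cvg_nrmP ux uc; apply/ler_addgt0Pl => e /ux[N1 uN].
apply: le_trans (nrm_tri x (u (maxn N N1)) y) _; apply: lerD.
  by rewrite nrmBC ltW // uN // leq_maxr.
by rewrite uc // leq_maxl.
Qed.

End Normed.

Lemma cauchy_nrm (E : completeNormedModType C) (u : nat -> E) :
  (forall e : R, 0 < e -> exists N, forall m n, (N <= m)%N -> (N <= n)%N ->
     nrm (u m - u n) < e) ->
  exists x : E, u n @[n --> \oo] --> x.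
Proof.
move=> uc; suff /cvg_ex : cvg (u @ \oo) by [].
apply: cauchy_cvg; apply: cauchy_exP => e e0.
have /uc[N uN] : 0 < complex.Re e by rewrite -ltcR -ge0_ReK // ltW.
exists (u N); exists N => // n /= Nn.
by rewrite -ball_normE /ball_ /= nrmE (ge0_ReK (ltW e0)) ltcR uN.
Qed.

(** Applied at every vector to an iteration of operators, the error bound at
    [n = 0] is a norm bound for the limit operator. *)
Lemma geometric_cvg (E : completeNormedModType C) (u : nat -> E) (c q : R) :
  0 <= q < 1 -> (forall n, nrm (u n.+1 - u n) <= c * q ^+ n) ->
  exists2 x : E, u n @[n --> \oo] --> x &
    forall n, nrm (x - u n) <= c * q ^+ n / (1 - q).
Proof.
move=> /andP[q0 q1] uq.
have c0 : 0 <= c.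
  by have := le_trans (nrm_ge0 _) (uq 0%N); rewrite expr0 mulr1.
have tail n m : nrm (u (n + m)%N - u n) <= c * q ^+ n / (1 - q).
  have : nrm (u (n + m)%N - u n) <= c * q ^+ n * (1 - q ^+ m) / (1 - q).
    elim: m => [|m IH]; first by rewrite addn0 subrr nrm0 expr0 subrr mulr0 mul0r.
    rewrite addnS; apply: le_trans (nrm_tri _ (u (n + m)%N) _) _.
    apply: le_trans (lerD (uq _) IH) _.
    rewrite le_eqVlt; apply/orP; left; apply/eqP.
    by rewrite exprD exprS; field; rewrite subr_eq0 gt_eqF.
  move=> /le_trans; apply; rewrite ler_pM2r ?invr_gt0 ?subr_gt0 //.
  by rewrite ler_piMr ?mulr_ge0 ?exprn_ge0 // gerBl exprn_ge0.
have qn : c * q ^+ n / (1 - q) @[n --> \oo] --> (0 : R).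
  rewrite -(mul0r (1 - q)^-1); apply: cvgMl.
  rewrite -(mulr0 c); apply: cvgMr.
  by apply: cvg_expr; rewrite ger0_norm.
have [x ux] : exists x : E, u n @[n --> \oo] --> x.
  apply: cauchy_nrm => e e0.
  have e20 : 0 < e / 2 by rewrite divr_gt0.
  have [N _ hN] := cvgr0_norm_lt _ qn _ e20.
  exists N => m n Nm Nn; rewrite [e]splitr.
  apply: le_lt_trans (nrm_tri _ (u N) _) _; apply: ltrD.
    rewrite -(subnKC Nm); apply: le_lt_trans (tail _ _) _.
    by apply: le_lt_trans (ler_norm _) (hN _ _) => /=.
  rewrite nrmBC -(subnKC Nn); apply: le_lt_trans (tail _ _) _.
  by apply: le_lt_trans (ler_norm _) (hN _ _) => /=.
exists x => // n; apply: (cvg_nrm_le (N := n) ux) => m nm.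
by rewrite -(subnKC nm).
Qed.

End RealNorm.

(** * The real inner product *)

Section RealDot.
Variables (R : realType).
Local Notation C := R[i].
Local Open Scope complex_scope.

Section Dot.
Variable H : hilbertType R.
Implicit Types x y z : H.

(** The real part of the inner product determines it, and it lives in an
    ordered field, where estimates can be done. *)
Definition rdot x y : R := complex.Re (hdot x y).

Lemma hdotE x y : hdot x y = rdot x y +i* rdot x ('i *: y).
Proof.
rewrite /rdot linearZr_LR /=; case: (hdot x y) => a b /=.
by congr (_ +i* _); ring.
Qed.

Lemma hdotC x y : hdot y x = conjc (hdot x y).
Proof. by rewrite hermC /= mul1r. Qed.

Lemma hdotZl a x y : hdot (a *: x) y = a * hdot x y.
Proof. by rewrite linearZl_LR. Qed.

Lemma hdotZr a x y : hdot x (a *: y) = conjc a * hdot x y.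
Proof. by rewrite linearZr_LR. Qed.

Lemma hdotDl x y z : hdot (x + y) z = hdot x z + hdot y z.
Proof. exact: linearDl. Qed.

Lemma hdotDr x y z : hdot z (x + y) = hdot z x + hdot z y.
Proof. exact: linearDr. Qed.

Lemma hdot0l x : hdot 0 x = 0. Proof. exact: linear0l. Qed.
Lemma hdot0r x : hdot x 0 = 0. Proof. exact: linear0r. Qed.

Lemma hdotNl x y : hdot (- x) y = - hdot x y.
Proof. exact: linearNl. Qed.
Lemma hdotNr x y : hdot x (- y) = - hdot x y.
Proof. exact: linearNr. Qed.

Lemma hdotBl x y z : hdot (x - y) z = hdot x z - hdot y z.
Proof. by rewrite hdotDl hdotNl. Qed.
Lemma hdotBr x y z : hdot z (x - y) = hdot z x - hdot z y.
Proof. by rewrite hdotDr hdotNr. Qed.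

Lemma hdot_suml n (F : 'I_n -> H) y :
  hdot (\sum_i F i) y = \sum_i hdot (F i) y.
Proof. by elim/big_ind2: _ => [|_ a _ b <- <-|//]; rewrite ?hdot0l ?hdotDl. Qed.

Lemma hdot_sumr n (F : 'I_n -> H) y :
  hdot y (\sum_i F i) = \sum_i hdot y (F i).
Proof. by elim/big_ind2: _ => [|_ a _ b <- <-|//]; rewrite ?hdot0r ?hdotDr. Qed.

Lemma rdotC x y : rdot x y = rdot y x.
Proof. by rewrite /rdot hdotC; case: (hdot y x). Qed.

Lemma rdotDl x y z : rdot (x + y) z = rdot x z + rdot y z.
Proof. by rewrite /rdot hdotDl; case: (hdot x z); case: (hdot y z). Qed.

Lemma rdotDr x y z : rdot z (x + y) = rdot z x + rdot z y.
Proof. by rewrite rdotC rdotDl !(rdotC z). Qed.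

Lemma rdotNl x y : rdot (- x) y = - rdot x y.
Proof. by rewrite /rdot hdotNl; case: (hdot x y). Qed.

Lemma rdotNr x y : rdot x (- y) = - rdot x y.
Proof. by rewrite rdotC rdotNl rdotC. Qed.

Lemma rdotBl x y z : rdot (x - y) z = rdot x z - rdot y z.
Proof. by rewrite rdotDl rdotNl. Qed.

Lemma rdotBr x y z : rdot z (x - y) = rdot z x - rdot z y.
Proof. by rewrite rdotDr rdotNr. Qed.

Lemma rdotZl (t : R) x y : rdot (t%:C *: x) y = t * rdot x y.
Proof. by rewrite /rdot hdotZl; case: (hdot x y) => a b /=; ring. Qed.

Lemma rdotZr (t : R) x y : rdot x (t%:C *: y) = t * rdot x y.
Proof. by rewrite rdotC rdotZl rdotC. Qed.

Lemma rdotZi x y : rdot ('i *: x) ('i *: y) = rdot x y.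
Proof.
by rewrite /rdot hdotZl hdotZr; case: (hdot x y) => a b /=; ring.
Qed.

Lemma rdot0l x : rdot 0 x = 0. Proof. by rewrite /rdot hdot0l. Qed.
Lemma rdot0r x : rdot x 0 = 0. Proof. by rewrite rdotC rdot0l. Qed.

Lemma hdot_nrm x : hdot x x = (nrm x ^+ 2)%:C.
Proof. by rewrite -hdot_norm nrmE rmorphXn. Qed.

Lemma rdot_nrm x : rdot x x = nrm x ^+ 2.
Proof. by rewrite /rdot hdot_nrm. Qed.

Lemma hdotxx_eq0 x : hdot x x = 0 -> x = 0.
Proof.
rewrite hdot_nrm => /(congr1 (@complex.Re R))/= /eqP.
by rewrite sqrf_eq0 => /eqP/nrm_eq0.
Qed.

Lemma nrmZr (t : R) x : 0 <= t -> nrm (t%:C *: x) = t * nrm x.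
Proof. by move=> t0; rewrite nrmZ cabs_real ger0_norm. Qed.

Lemma nrm_sqrD x y : nrm (x + y) ^+ 2 = nrm x ^+ 2 + 2 * rdot x y + nrm y ^+ 2.
Proof. by rewrite -!rdot_nrm rdotDl !rdotDr (rdotC y x); ring. Qed.

Lemma nrm_sqrB x y : nrm (x - y) ^+ 2 = nrm x ^+ 2 - 2 * rdot x y + nrm y ^+ 2.
Proof. by rewrite -!rdot_nrm rdotBl !rdotBr (rdotC y x); ring. Qed.

Lemma rdot_le x y : rdot x y <= nrm x * nrm y.
Proof.
have [y0|y0] := eqVneq (nrm y) 0.
  by rewrite y0 mulr0 (nrm_eq0 y0) rdot0r.
have yp : 0 < nrm y by rewrite lt_neqAle eq_sym y0 nrm_ge0.
have : 0 <= nrm ((nrm y)%:C *: x - (nrm x)%:C *: y) ^+ 2.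
  exact: exprn_ge0 (nrm_ge0 _).
rewrite nrm_sqrB !nrmZr ?nrm_ge0 // rdotZl rdotZr => h.
have [x0|x0] := eqVneq (nrm x) 0.
  by rewrite x0 mul0r (nrm_eq0 x0) rdot0l.
have xp : 0 < nrm x by rewrite lt_neqAle eq_sym x0 nrm_ge0.
rewrite -(ler_pM2l (mulr_gt0 yp xp)).
have -> : nrm y * nrm x * rdot x y = nrm y * (nrm x * rdot x y) by ring.
nra.
Qed.

Lemma rdot_abs_le x y : `|rdot x y| <= nrm x * nrm y.
Proof.
by rewrite ler_norml rdot_le andbT lerNl -rdotNl -(nrmN x) rdot_le.
Qed.

Lemma hdot_ext x y : (forall z, rdot x z = rdot y z) -> x = y.
Proof.
move=> xy; apply/eqP; rewrite -subr_eq0; apply/eqP; apply: hdotxx_eq0.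
by rewrite hdot_nrm -rdot_nrm rdotBl xy subrr.
Qed.

Lemma rdot_cvgl (u : nat -> H) x y : u n @[n --> \oo] --> x ->
  rdot (u n) y @[n --> \oo] --> rdot x y.
Proof.
move=> /cvg_nrmP ux; apply/cvgrPdist_lt => e e0.
have c0 : 0 < nrm y + 1 by rewrite ltr_wpDl ?nrm_ge0.
have [N uN] := ux _ (divr_gt0 e0 c0).
exists N => // n /= /uN; rewrite ltr_pdivlMr // nrmBC -rdotBl => h.
apply: le_lt_trans (rdot_abs_le _ _) _.
by apply: le_lt_trans h; rewrite ler_wpM2l ?nrm_ge0 // ler_wpDr.
Qed.

Lemma rdot_cvgr (u : nat -> H) x y : u n @[n --> \oo] --> x ->
  rdot y (u n) @[n --> \oo] --> rdot y x.
Proof.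
move=> ux; rewrite rdotC; apply: eq_cvg_seq (rdot_cvgl ux) => n.
exact: rdotC.
Qed.

End Dot.

End RealDot.

(** * Bounded operators *)

Section Linear.
Variables (R : pzRingType) (U V W : lmodType R).
Implicit Types (T : U -> V).

Lemma linear_D T x y : linear T -> T (x + y) = T x + T y.
Proof. by move=> lT; have := lT 1 x y; rewrite !scale1r. Qed.

Lemma linear_0 T : linear T -> T 0 = 0.
Proof. by move=> lT; apply: (addrI (T 0)); rewrite -linear_D // !addr0. Qed.

Lemma linear_Z T a x : linear T -> T (a *: x) = a *: T x.
Proof. by move=> lT; have := lT a x 0; rewrite linear_0 // !addr0. Qed.

Lemma linear_N T x : linear T -> T (- x) = - T x.
Proof. by move=> lT; rewrite -!scaleN1r linear_Z. Qed.

Lemma linear_B T x y : linear T -> T (x - y) = T x - T y.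
Proof. by move=> lT; rewrite linear_D // linear_N. Qed.

Lemma linear_sum_ord T n (F : 'I_n -> U) : linear T ->
  T (\sum_i F i) = \sum_i T (F i).
Proof.
by move=> lT; elim/big_ind2: _ => [|_ a _ b <- <-|//];
  rewrite ?linear_0 ?linear_D.
Qed.

Lemma linear_comp_fun T (S : V -> W) : linear T -> linear S -> linear (S \o T).
Proof. by move=> lT lS a x y /=; rewrite lT lS. Qed.

Lemma linear_iter (T : U -> U) n : linear T -> linear (iter n T).
Proof. by move=> lT; elim: n => [//|n IH] a x y /=; rewrite IH lT. Qed.

End Linear.

Section BoundedOperators.
Variable R : realType.
Local Notation C := R[i].
Local Open Scope complex_scope.
Implicit Types H K : hilbertType R.

Lemma linear_lim H K (S : nat -> H -> K) (T : H -> K) :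
  (forall n, linear (S n)) -> (forall x, S n x @[n --> \oo] --> T x) ->
  linear T.
Proof.
move=> lS ST a x y; apply: cvg_unique (ST _) _ => //.
have -> : (fun n => S n (a *: x + y)) = (fun n => a *: S n x + S n y).
  by apply/funext => n; rewrite lS.
by apply: cvgD => //; apply: cvgZr.
Qed.

Lemma bounded_opP H K (T : H -> K) : bounded_op T <->
  linear T /\ exists2 c : R, 0 < c & forall x, nrm (T x) <= c * nrm x.
Proof.
split=> -[lT]; last first.
  by move=> [c _ Tc]; split=> //; exists c%:C => x; rewrite !nrmE -rmorphM lecR.
move=> [c Tc]; split=> //; exists (cabs c + 1) => [|x].
  by rewrite ltr_wpDl ?cabs_ge0.
apply: le_trans (_ : cabs c * nrm x <= _); last first.
  by rewrite ler_wpM2r ?nrm_ge0 // lerDl.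
rewrite -lecR rmorphM /= -cabsE -!nrmE -[`|x|]normr_id -normrM.
by apply: le_trans (Tc x) _; rewrite real_ler_norm // ger0_real //
  (le_trans _ (Tc x)).
Qed.

Lemma bounded_linear H K (T : H -> K) : bounded_op T -> linear T.
Proof. by case. Qed.

Lemma bounded_comp H (T S : H -> H) :
  bounded_op T -> bounded_op S -> bounded_op (T \o S).
Proof.
move=> /bounded_opP[lT [c c0 Tc]] /bounded_opP[lS [d d0 Sd]].
apply/bounded_opP; split; first exact: linear_comp_fun.
exists (c * d) => [|x]; first exact: mulr_gt0.
by apply: le_trans (Tc _) _; rewrite -mulrA ler_pM2l.
Qed.

Lemma bounded_id H : bounded_op (@id H).
Proof. by apply/bounded_opP; split=> //; exists 1 => // x; rewrite mul1r. Qed.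

Lemma bounded_lin2 H K (T S : H -> K) (a : C) :
  bounded_op T -> bounded_op S -> bounded_op (fun x => a *: T x + S x).
Proof.
move=> /bounded_opP[lT [c c0 Tc]] /bounded_opP[lS [d d0 Sd]].
apply/bounded_opP; split.
  move=> b x y; rewrite lT lS !scalerDr !scalerA (mulrC a b).
  by rewrite -!addrA; congr (_ + _); rewrite addrCA.
exists (cabs a * c + d) => [|x].
  by rewrite ltr_wpDl // mulr_ge0 ?cabs_ge0 ?ltW.
apply: le_trans (nrmD _ _) _; rewrite nrmZ mulrDl -mulrA.
by apply: lerD => //; rewrite ler_wpM2l ?cabs_ge0.
Qed.

Lemma bounded_0 H K : bounded_op (fun _ : H => 0 : K).
Proof.
apply/bounded_opP; split=> [a x y|]; first by rewrite scaler0 addr0.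
by exists 1 => // x; rewrite nrm0 mul1r nrm_ge0.
Qed.

Lemma bounded_scale H K (T : H -> K) (a : C) :
  bounded_op T -> bounded_op (fun x => a *: T x).
Proof.
move=> bT; have := bounded_lin2 a bT (bounded_0 H K).
by congr bounded_op; apply/funext => x; rewrite addr0.
Qed.

Lemma bounded_add H K (T S : H -> K) :
  bounded_op T -> bounded_op S -> bounded_op (T \+ S).
Proof.
move=> bT bS; have := bounded_lin2 1 bT bS.
by congr bounded_op; apply/funext => x; rewrite scale1r.
Qed.

Lemma bounded_resolvent H (L : H -> H) (z : C) :
  bounded_op L -> bounded_op (fun x => x - z *: L x).
Proof.
move=> bL; have := bounded_lin2 (- z) bL (bounded_id H).
by congr bounded_op; apply/funext => x; rewrite addrC scaleNr.
Qed.

Lemma bounded_cvg H K (T : H -> K) (u : nat -> H) x : bounded_op T ->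
  u n @[n --> \oo] --> x -> T (u n) @[n --> \oo] --> T x.
Proof.
move=> /bounded_opP[lT [c c0 Tc]] /cvg_nrmP ux; apply/cvg_nrmP => e e0.
have [N uN] := ux _ (divr_gt0 e0 c0); exists N => n /uN.
rewrite ltr_pdivlMr // mulrC -linear_B //; exact: le_lt_trans.
Qed.

(** * Inverses *)

Section Inverse.
Variables (H : hilbertType R) (T S : H -> H).
Hypothesis TS : is_inverse T S.

Lemma is_inverseK x : S (T x) = x.
Proof. by case: TS => _ /(congr1 (@^~ x)). Qed.

Lemma is_inverseVK x : T (S x) = x.
Proof. by case: TS => _ _ /(congr1 (@^~ x)). Qed.

Lemma bounded_inverse : bounded_op S. Proof. by case: TS. Qed.

End Inverse.

Lemma is_inverseI H (T S : H -> H) : bounded_op S ->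
  cancel T S -> cancel S T -> is_inverse T S.
Proof. by move=> bS TS ST; split=> //; apply/funext. Qed.

Lemma op_inv_unique H (T S : H -> H) : is_inverse T S -> op_inv T = S.
Proof.
move=> iTS; apply: xget_unique => // S' iTS'; apply/funext => x.
by rewrite -(is_inverseK iTS (S' x)) (is_inverseVK iTS').
Qed.

(** Partial sums are kept in the conclusion because the resolvent is analytic
    through them. *)
Lemma neumann H (B : H -> H) (q : R) : linear B -> 0 <= q < 1 ->
  (forall x, nrm (B x) <= q * nrm x) ->
  exists2 S, is_inverse (fun x => x - B x) S &
    forall x, (\sum_(i < n) iter i B x) @[n --> \oo] --> S x.
Proof.
move=> lB q01 Bq; have /andP[q0 q1] := q01.
have itB n x : nrm (iter n B x) <= q ^+ n * nrm x.
  elim: n => [|n IH]; first by rewrite expr0 mul1r.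
  by apply: le_trans (Bq _) _; rewrite exprS -mulrA ler_wpM2l.
have /choice[S uS] x : exists s, (\sum_(i < n) iter i B x) @[n --> \oo] --> s
    /\ nrm s <= nrm x / (1 - q).
  have [n|s us sb] := geometric_cvg (c := nrm x)
      (u := fun n => \sum_(i < n) iter i B x) q01.
    by rewrite big_ord_recr /= addrAC subrr add0r mulrC.
  exists s; split=> //; have := sb 0%N.
  by rewrite big_ord0 subr0 expr0 mulr1.
have lS : linear S.
  apply: (linear_lim (S := fun n x => \sum_(i < n) iter i B x)) => [n a x y|x].
    rewrite scaler_sumr -big_split /=; apply: eq_bigr => i _.
    by rewrite (linear_iter _ lB).
  by case: (uS x).
have bB : bounded_op B.
  apply/bounded_opP; split=> //; exists (q + 1); first by rewrite ltr_wpDl.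
  move=> x; apply: le_trans (Bq x) _.
  by rewrite ler_wpM2r ?nrm_ge0 // lerDl.
have bB1 : bounded_op (fun x => x - B x).
  by have := bounded_resolvent 1 bB; congr bounded_op; apply/funext => x;
    rewrite scale1r.
have it0 x : iter n B x @[n --> \oo] --> 0.
  have qn : nrm x * q ^+ n @[n --> \oo] --> (0 : R).
    by rewrite -(mulr0 (nrm x)); apply: cvgMr; apply: cvg_expr;
      rewrite ger0_norm.
  apply/cvg_nrmP => e e0; have [N _ hN] := cvgr0_norm_lt _ qn _ e0.
  exists N => n /hN /=; rewrite subr0; apply: le_lt_trans.
  by apply: le_trans (itB _ _) _; rewrite mulrC ler_norm.
have tele x n : \sum_(i < n) iter i B (x - B x) = x - iter n B x.
  elim: n => [|n IH]; first by rewrite big_ord0 subrr.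
  rewrite big_ord_recr /= IH (linear_B _ _ (linear_iter _ lB)).
  by rewrite addrA subrK -iterSr.
have telecvg x : (\sum_(i < n) iter i B (x - B x)) @[n --> \oo] --> x.
  rewrite -[X in _ --> X]subr0.
  have -> : (fun n => \sum_(i < n) iter i B (x - B x)) =
            (fun n => x - iter n B x) by apply/funext => n; rewrite tele.
  by apply: cvgB; [exact: cvg_cst|exact: it0].
exists S => [|x]; last by case: (uS x).
split.
- apply/bounded_opP; split=> //; exists (1 - q)^-1.
    by rewrite invr_gt0 subr_gt0.
  by move=> x; case: (uS x) => _; rewrite mulrC.
- apply/funext => x /=; case: (uS (x - B x)) => ux _.
  exact: cvg_unique ux (telecvg x).
- apply/funext => x /=; case: (uS x) => /(bounded_cvg bB1) ux _.
  apply: cvg_unique ux _ => //; apply: eq_cvg_seq (telecvg x) => n.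
  rewrite (linear_sum_ord _ lB) -sumrB.
  apply: eq_bigr => i _; rewrite (linear_B _ _ (linear_iter _ lB)).
  by rewrite -iterSr.
Qed.

Definition coercive H (A : H -> H) : Prop :=
  exists2 c : R, 0 < c & forall x, c * nrm x ^+ 2 <= rdot (A x) x.

(** With [c] a coercivity constant and [k] a bound of [A],
    [|x - t A x| ^ 2 <= (1 - 2 t c + t ^ 2 k ^ 2) |x| ^ 2]; the step
    [t = c / k ^ 2] minimizes the right-hand side, at [1 - (c / k) ^ 2]. *)
Lemma coercive_contraction H (A : H -> H) : bounded_op A -> coercive A ->
  exists t q : R, [/\ 0 < t, 0 <= q < 1 &
    forall x, nrm (x - t%:C *: A x) <= q * nrm x].
Proof.
move=> /bounded_opP[lA [k' k'0 Ak']] [c c0 Ac].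
(* enlarged so that [c / k <= 1] *)
pose k := k' + c; have k0 : 0 < k by rewrite addr_gt0.
have Ak x : nrm (A x) <= k * nrm x.
  by apply: le_trans (Ak' x) _; rewrite ler_wpM2r ?nrm_ge0 // lerDl ltW.
pose r := c / k.
have r0 : 0 < r by rewrite divr_gt0.
have r1 : r <= 1 by rewrite ler_pdivrMr // mul1r lerDr ltW.
exists (c / k ^+ 2), (Num.sqrt (1 - r ^+ 2)); split.
- by rewrite divr_gt0 // exprn_gt0.
- rewrite sqrtr_ge0 /= -[ltRHS]sqrtr1 ltr_sqrt // ltrBlDr ltrDl.
  exact: exprn_gt0.
- move=> x.
  have r2 : 0 <= 1 - r ^+ 2 by rewrite subr_ge0 expr_le1 // ltW.
  rewrite -(ler_pXn2r (n := 2)) ?nnegrE ?mulr_ge0 ?sqrtr_ge0 ?nrm_ge0 //.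
  have t0 : 0 < c / k ^+ 2 by rewrite divr_gt0 // exprn_gt0.
  rewrite exprMn sqr_sqrtr // nrm_sqrB rdotZr (nrmZr _ (ltW t0)) exprMn.
  have : nrm (A x) ^+ 2 <= k ^+ 2 * nrm x ^+ 2.
    by rewrite -exprMn ler_pXn2r ?nnegrE ?mulr_ge0 ?nrm_ge0 // ltW.
  move=> /(ler_wpM2l (exprn_ge0 2 (ltW t0))) h1.
  have h2 := ler_wpM2l (ltW t0) (Ac x); rewrite rdotC in h2.
  have e1 : (c / k ^+ 2) ^+ 2 * (k ^+ 2 * nrm x ^+ 2) = r ^+ 2 * nrm x ^+ 2.
    by rewrite /r; field; rewrite gt_eqF.
  have e2 : c / k ^+ 2 * (c * nrm x ^+ 2) = r ^+ 2 * nrm x ^+ 2.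
    by rewrite /r; field; rewrite gt_eqF.
  move: h1 h2; rewrite e1 e2.
  move: (c / k ^+ 2) (nrm (A x)) (rdot x (A x)) (nrm x) => t a b d h1 h2.
  lra.
Qed.

(** By the contraction property [t A] is inverted by a Neumann series. *)
Lemma coercive_inverse H (A : H -> H) :
  bounded_op A -> coercive A -> exists S, is_inverse A S.
Proof.
move=> bA cA; have [t [q [t0 q01 Aq]]] := coercive_contraction bA cA.
have tN0 : t%:C != 0 :> C.
  by apply/eqP => /(congr1 (@complex.Re R)) /= te; rewrite te ltxx in t0.
have bB : bounded_op (fun x => x - t%:C *: A x) by exact: bounded_resolvent.
have [S [bS SA AS] _] := neumann (bounded_linear bB) q01 Aq.
exists (fun x => t%:C *: S x); split; first exact: bounded_scale.
- apply/funext => x /=; have := congr1 (@^~ x) SA => /=.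
  by rewrite opprB addrCA subrr addr0 linear_Z //; exact: bounded_linear.
- apply/funext => x /=; have := congr1 (@^~ x) AS => /=.
  by rewrite opprB addrCA subrr addr0 linear_Z //; exact: bounded_linear.
Qed.
End BoundedOperators.

(** * Orthogonal projection *)

Section Projection.
Variable R : realType.
Local Notation C := R[i].
Local Open Scope complex_scope.
Implicit Types H : hilbertType R.

Definition linear_set H (D : set H) : Prop :=
  D 0 /\ forall a x y, D x -> D y -> D (a *: x + y).

Lemma linear_set_D H (D : set H) x y : linear_set D -> D x -> D y -> D (x + y).
Proof. by move=> [_ lD] Dx Dy; rewrite -[x]scale1r; exact: lD. Qed.

Lemma linear_set_Z H (D : set H) a x : linear_set D -> D x -> D (a *: x).
Proof. by move=> [D0 lD] Dx; rewrite -[_ *: _]addr0; exact: lD. Qed.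

Lemma rdot_linear_set H (D : set H) x : linear_set D ->
  (forall d, D d -> rdot x d = 0) -> forall d, D d -> hdot x d = 0.
Proof.
move=> lD xD d Dd; rewrite hdotE !xD //; exact: linear_set_Z.
Qed.

(** The parallelogram identity makes minimizing sequences of the distance to
    [D] Cauchy. The foot [p] of the perpendicular lies in the closure of [D],
    which is why it comes with a sequence of [D] that converges to it. *)
Lemma projection H (D : set H) (h : H) : linear_set D ->
  exists p, (exists2 u : nat -> H, (forall n, D (u n)) & u n @[n --> \oo] --> p)
    /\ forall d, D d -> rdot (h - p) d = 0.
Proof.
move=> lD; have [D0 _] := lD.
pose iv (n : nat) : R := n.+1%:R^-1.
pose A := [set nrm (h - d) ^+ 2 | d in D].
have infA : has_inf A.
  split; first by exists (nrm (h - 0) ^+ 2), 0.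
  by exists 0 => _ [d _ <-]; exact: exprn_ge0 (nrm_ge0 _).
pose s := inf A.
have sA d : D d -> s <= nrm (h - d) ^+ 2.
  by move=> Dd; apply: ge_inf; [case: infA|exists d].
have /choice[u uP] (n : nat) :
    exists d, D d /\ nrm (h - d) ^+ 2 < s + iv n.
  have [|_ [d Dd <-] hd] := @inf_adherent _ A (iv n) _ infA.
    by rewrite invr_gt0.
  by exists d.
have inv_le (N n : nat) : (N <= n)%N -> iv n <= iv N.
  by move=> Nn; rewrite lef_pV2 ?posrE ?ltr0n // ler_nat.
have smallN (e : R) : 0 < e -> exists N : nat, iv N < e.
  move=> e0; have := @cvg_harmonic R; move/cvgrPdist_lt/(_ _ e0) => [N _ /(_ N)].
  rewrite /= sub0r normrN ger0_norm ?invr_ge0 // => hN.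
  by exists N; exact: hN.
have uC (m n : nat) :
    nrm (u m - u n) ^+ 2 <= 2 * (iv m + iv n).
  have [Dm hm] := uP m; have [Dn hn] := uP n.
  have Dmid : D ((2^-1 : R)%:C *: (u m + u n)).
    by apply: linear_set_Z => //; exact: linear_set_D.
  have := sA _ Dmid.
  have -> : h - (2^-1 : R)%:C *: (u m + u n) =
            (2^-1 : R)%:C *: ((h - u m) + (h - u n)).
    rewrite addrACA -opprD scalerBr; congr (_ - _).
    rewrite (_ : h + h = 2%:R *: h); last by rewrite scaler_nat mulr2n.
    rewrite scalerA -[LHS]scale1r; congr (_ *: _).
    by apply/eqP; rewrite eq_complex /=; apply/andP; split; apply/eqP; field.
  rewrite nrmZr ?invr_ge0 // exprMn => hs.
  have -> : u m - u n = (h - u n) - (h - u m).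
    by rewrite opprB [RHS]addrC addrA subrK.
  have e1 := nrm_sqrD (h - u m) (h - u n).
  have e2 := nrm_sqrB (h - u n) (h - u m).
  rewrite (rdotC (h - u n)) in e2.
  have h4 : s * 4 <= nrm (h - u m + (h - u n)) ^+ 2.
    rewrite -ler_pdivlMr // mulrC; apply: le_trans hs _.
    by rewrite le_eqVlt; apply/orP; left; apply/eqP; field.
  lra.
have [p up] : exists p : H, u n @[n --> \oo] --> p.
  apply: cauchy_nrm => e e0.
  have [N hN] : exists N : nat, iv N < e ^+ 2 / 4.
    by apply: smallN; rewrite divr_gt0 // exprn_gt0.
  exists N => m n Nm Nn.
  rewrite -(ltr_pXn2r (n := 2)) ?nnegrE ?nrm_ge0 ?ltW //.
  have := uC m n; have := inv_le _ _ Nm; have := inv_le _ _ Nn.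
  rewrite ltr_pdivlMr // in hN; lra.
exists p; split; first by exists u => // n; case: (uP n).
move=> d Dd.
(* [u n + t d] is no closer to [h] than the infimum, which [u n] attains up
   to [1 / (n + 1)] *)
have key (t : R) : 0 <= t ^+ 2 * nrm d ^+ 2 - 2 * (t * rdot (h - p) d).
  apply/ler_addgt0Pr => e /smallN[N hN].
  have cv : t ^+ 2 * nrm d ^+ 2 - 2 * (t * rdot (h - u n) d) @[n --> \oo]
      --> t ^+ 2 * nrm d ^+ 2 - 2 * (t * rdot (h - p) d).
    apply: cvgB; first exact: cvg_cst.
    apply: cvgMr; apply: cvgMr; apply: rdot_cvgl.
    by apply: cvgB => //; exact: cvg_cst.
  rewrite -lerBlDr sub0r; apply: (cvgr_to_ge cv).
  exists N => // n /= /inv_le nN; have [Dn hn] := uP n.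
  have Dt : D (t%:C *: d + u n) by case: lD => _; apply.
  have := sA _ Dt.
  have -> : h - (t%:C *: d + u n) = (h - u n) - t%:C *: d.
    by rewrite opprD [- _ - _]addrC addrA.
  rewrite nrm_sqrB rdotZr nrmZ cabs_real exprMn -normrX ger0_norm ?sqr_ge0 //.
  lra.
set r := rdot (h - p) d in key *.
have [d0|d0] := eqVneq (nrm d) 0; first by rewrite /r (nrm_eq0 d0) rdot0r.
have n0 : 0 < nrm d ^+ 2 by rewrite exprn_gt0 // lt_neqAle eq_sym d0 nrm_ge0.
have := key (r / nrm d ^+ 2).
have -> : (r / nrm d ^+ 2) ^+ 2 * nrm d ^+ 2 - 2 * (r / nrm d ^+ 2 * r) =
          - (r ^+ 2 / nrm d ^+ 2) by field.
rewrite oppr_ge0 pmulr_lle0 ?invr_gt0 // => r2.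
by apply/eqP; rewrite -sqrf_eq0 eq_le r2 sqr_ge0.
Qed.

(** The vector from a point to the foot of its perpendicular on [D] is
    orthogonal to [D], so it is 0. *)
Lemma dense_linear_set H (D : set H) : linear_set D ->
  (forall h, (forall d, D d -> hdot h d = 0) -> h = 0) ->
  forall h : H, exists2 u : nat -> H,
    (forall n, D (u n)) & u n @[n --> \oo] --> h.
Proof.
move=> lD tD h; have [p [[u Du up] pD]] := projection h lD.
exists u => //; suff -> : h = p by [].
by apply/eqP; rewrite -subr_eq0; apply/eqP/tD/rdot_linear_set.
Qed.

(** * Adjoints *)

(** The functional [x |-> hdot (T x) y] is continuous, so it vanishes at the
    foot [p] of the perpendicular from [h] to its kernel; the perpendicular
    [h - p] therefore spans the complement of the kernel and, suitably scaled,
    represents the functional. *)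
Lemma riesz H (T : H -> H) (y : H) : bounded_op T ->
  exists z, forall x, hdot (T x) y = hdot x z.
Proof.
move=> bT; have lT := bounded_linear bT.
have [[h hy]|] := pselect (exists h, hdot (T h) y <> 0); last first.
  move=> /forallNP h0; exists 0 => x; rewrite hdot0r.
  exact: contrapT (h0 x).
pose D := [set x : H | hdot (T x) y = 0].
have lD : linear_set D.
  split=> [|a x z]; rewrite /D /=; first by rewrite linear_0 // hdot0l.
  by move=> x0 z0; rewrite lT hdotDl hdotZl x0 z0 mulr0 addr0.
have [p [[u Du up] pD]] := projection h lD.
have Tp : hdot (T p) y = 0.
  have Tup := bounded_cvg bT up.
  have z0 w : (forall n, rdot (T (u n)) w = 0) -> rdot (T p) w = 0.
    move=> uw; have := rdot_cvgl (y := w) Tup.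
    rewrite (_ : (fun n => _) = (fun=> 0)); last exact/funext.
    by move=> c; apply: cvg_unique c _ => //; exact: cvg_cst.
  have Du' n : rdot (T (u n)) y = 0 /\ rdot (T (u n)) ('i *: y) = 0.
    by have := Du n; rewrite /D /= hdotE => -[-> ->].
  by rewrite hdotE !z0 // => n; case: (Du' n).
pose v := h - p.
have vy : hdot (T v) y = hdot (T h) y by rewrite linear_B // hdotBl Tp subr0.
have vD := rdot_linear_set lD pD.
have v0 : hdot v v != 0.
  apply/eqP => /hdotxx_eq0 v0; apply: hy; rewrite -vy v0 linear_0 //.
  exact: hdot0l.
have {}hy : hdot (T v) y != 0 by rewrite vy; exact/eqP.
exists ((conjc (hdot (T v) y) / hdot v v) *: v) => x.
have Dx : D (x - (hdot (T x) y / hdot (T v) y) *: v).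
  rewrite /D /= linear_B // linear_Z // hdotBl hdotZl divfK //.
  by rewrite subrr.
have := vD _ Dx; rewrite hdotBr hdotZr => /eqP; rewrite subr_eq0 => /eqP.
move=> /(congr1 conjc); rewrite -hdotC hdotZr => ->.
rewrite !rmorphM /= !conjcK -hdotC conjc_inv -hdotC.
by rewrite -/v; field; rewrite v0 hy.
Qed.

Lemma adjointP H (T : H -> H) : bounded_op T ->
  bounded_op (adjoint T) /\ forall x y, hdot (T x) y = hdot x (adjoint T y).
Proof.
move=> bT; have /bounded_opP[lT [c c0 Tc]] := bT.
have /choice[S TS'] y := riesz y bT.
have TS x y : hdot (T x) y = hdot x (S y) by [].
have dS x y : rdot (T x) y = rdot x (S y) by rewrite /rdot TS.
suff bS : bounded_op S.
  exact: (@xgetI _ (fun=> 0) [set S | bounded_op S /\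
    forall x y, hdot (T x) y = hdot x (S y)] S (conj bS TS)).
apply/bounded_opP; split.
  move=> a x y; apply: hdot_ext => z; rewrite rdotC [RHS]rdotC /rdot.
  by rewrite -TS hdotDr hdotZr !TS hdotDr hdotZr.
exists c => // y; have [S0|S0] := eqVneq (nrm (S y)) 0.
  by rewrite S0 mulr_ge0 ?nrm_ge0 // ltW.
have Sp : 0 < nrm (S y) by rewrite lt_neqAle eq_sym S0 nrm_ge0.
rewrite -(ler_pM2l Sp) -expr2 -rdot_nrm -dS.
apply: le_trans (rdot_le _ _) _; rewrite mulrA ler_wpM2r ?nrm_ge0 //.
by rewrite mulrC.
Qed.

Lemma bounded_adjoint H (T : H -> H) : bounded_op T -> bounded_op (adjoint T).
Proof. by case/adjointP. Qed.

Lemma hdot_adjr H (T : H -> H) x y : bounded_op T ->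
  hdot (T x) y = hdot x (adjoint T y).
Proof. by case/adjointP. Qed.

Lemma hdot_adjl H (T : H -> H) x y : bounded_op T ->
  hdot (adjoint T x) y = hdot x (T y).
Proof. by move=> bT; rewrite hdotC -hdot_adjr // -hdotC. Qed.

Lemma adjoint_unique H (T S : H -> H) : bounded_op S ->
  (forall x y, hdot (T x) y = hdot x (S y)) -> adjoint T = S.
Proof.
move=> bS TS; apply: xget_unique => // S' [_ TS'].
apply/funext => y; apply: hdot_ext => x.
by rewrite rdotC [RHS]rdotC /rdot -TS -TS'.
Qed.

Lemma is_inverse_adjoint H (T S : H -> H) : bounded_op T -> is_inverse T S ->
  is_inverse (adjoint T) (adjoint S).
Proof.
move=> bT TS; have bS := bounded_inverse TS.
apply: is_inverseI => [|x|x]; first exact: bounded_adjoint.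
- by apply: hdot_ext => y; rewrite /rdot !hdot_adjl // (is_inverseVK TS).
- by apply: hdot_ext => y; rewrite /rdot !hdot_adjl // (is_inverseK TS).
Qed.

Lemma op_invP H (T : H -> H) : (exists S, is_inverse T S) ->
  is_inverse T (op_inv T).
Proof. by move=> [S iS]; rewrite (op_inv_unique iS). Qed.

Lemma is_inverse_comp H (T S T' S' : H -> H) :
  is_inverse T S -> is_inverse T' S' -> is_inverse (T \o T') (S' \o S).
Proof.
move=> iS iS'; apply: is_inverseI => [|x|x] /=.
- exact: bounded_comp (bounded_inverse iS') (bounded_inverse iS).
- by rewrite (is_inverseK iS) (is_inverseK iS').
- by rewrite (is_inverseVK iS') (is_inverseVK iS).
Qed.

(** * Positive operators and square roots *)

Definition symmetric_op H (T : H -> H) : Prop :=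
  forall x y, rdot (T x) y = rdot x (T y).

Lemma hdot_symmetric H (T : H -> H) : linear T -> symmetric_op T ->
  forall x y, hdot (T x) y = hdot x (T y).
Proof. by move=> lT sT x y; rewrite !hdotE !sT linear_Z. Qed.

Lemma hdotTx_real H (T : H -> H) x : linear T -> symmetric_op T ->
  hdot (T x) x = (rdot (T x) x)%:C.
Proof.
move=> lT sT; rewrite hdotE; suff -> : rdot (T x) ('i *: x) = 0 by [].
have : rdot (T x) ('i *: x) = - rdot (T x) ('i *: x).
  rewrite [LHS]sT linear_Z // -[in LHS](rdotZi x) scalerA.
  have -> : 'i * 'i = -1 :> C by rewrite -expr2 sqr_i.
  by rewrite scaleN1r rdotNr rdotC.
lra.
Qed.

Lemma positive_opI H (T : H -> H) : bounded_op T -> symmetric_op T ->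
  (forall x, 0 <= rdot (T x) x) -> positive_op T.
Proof.
move=> bT sT pT; split=> // x; rewrite hdotTx_real ?ler0c //.
exact: bounded_linear.
Qed.

Lemma positive_rdot_ge0 H (T : H -> H) x : positive_op T -> 0 <= rdot (T x) x.
Proof. by move=> [_ /(_ x)]; rewrite /rdot lecE => /andP[]. Qed.

(** Over the complex numbers positivity implies symmetry, by polarization. *)
Lemma positive_symmetric H (T : H -> H) : positive_op T -> symmetric_op T.
Proof.
move=> [/bounded_linear lT pT].
have im0 z : rdot (T z) ('i *: z) = 0.
  by have := pT z; rewrite hdotE lecE /= => /andP[/eqP].
have im2 x y : rdot (T x) ('i *: y) + rdot (T y) ('i *: x) = 0.
  have := im0 (x + y); rewrite linear_D // scalerDr !rdotDl !rdotDr !im0.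
  by rewrite add0r addr0.
move=> x y; have := im2 x (- ('i *: y)).
rewrite scalerN scalerA; have -> : 'i * 'i = -1 :> C by rewrite -expr2 sqr_i.
rewrite scaleN1r opprK linear_N // linear_Z // rdotNl rdotZi => /eqP.
by rewrite subr_eq0 => /eqP->; rewrite rdotC.
Qed.

Lemma positive_bounded H (T : H -> H) : positive_op T -> bounded_op T.
Proof. by case. Qed.

(** With [k] a bound of [T], testing positivity at [x - T x / k] gives
    [|T x| ^ 2 <= k * rdot (T x) x]. *)
Lemma positive_coercive H (T S : H -> H) :
  positive_op T -> is_inverse T S -> coercive T.
Proof.
move=> pT TS; have sT := positive_symmetric pT.
have /bounded_opP[lT [k k0 Tk]] := positive_bounded pT.
have /bounded_opP[_ [c c0 Sc]] := bounded_inverse TS.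
exists (k * c ^+ 2)^-1 => [|x]; first by rewrite invr_gt0 mulr_gt0 ?exprn_gt0.
rewrite mulrC ler_pdivrMr ?mulr_gt0 ?exprn_gt0 //.
have h1 : nrm (T x) ^+ 2 <= k * rdot (T x) x.
  have := positive_rdot_ge0 (x - (k^-1)%:C *: T x) pT.
  rewrite linear_B // linear_Z // rdotBl !rdotBr !rdotZl !rdotZr.
  rewrite (sT (T x) x) !rdot_nrm => h.
  have h2 : rdot (T (T x)) (T x) <= k * nrm (T x) ^+ 2.
    apply: le_trans (rdot_le _ _) _; rewrite expr2 mulrA.
    by rewrite ler_wpM2r ?nrm_ge0.
  have h3 : k^-1 * (k^-1 * rdot (T (T x)) (T x)) <= k^-1 * nrm (T x) ^+ 2.
    rewrite ler_wpM2l ?invr_ge0 ?(ltW k0) // mulrC ler_pdivrMr //.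
    by rewrite mulrC.
  rewrite -ler_pdivrMl //; lra.
have h4 : nrm x ^+ 2 <= c ^+ 2 * nrm (T x) ^+ 2.
  rewrite -exprMn ler_pXn2r ?nnegrE ?nrm_ge0 ?mulr_ge0 ?nrm_ge0 ?(ltW c0) //.
  by rewrite -{1}(is_inverseK TS x).
apply: le_trans h4 _.
have -> : rdot (T x) x * (k * c ^+ 2) = c ^+ 2 * (k * rdot (T x) x) by ring.
by rewrite ler_pM2l ?exprn_gt0.
Qed.

Section SquareRoot.
Variables (H : hilbertType R) (B : H -> H) (q : R).
Hypotheses (bB : bounded_op B) (sB : symmetric_op B) (q01 : 0 <= q < 1).
Hypothesis Bq : forall x, nrm (B x) <= q * nrm x.

Let q0 : 0 <= q. Proof. by case/andP: q01. Qed.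
Let q1 : q < 1. Proof. by case/andP: q01. Qed.
Let lB := bounded_linear bB.

(** Iterating [Y -> (B + Y ^ 2) / 2], which preserves and contracts the ball
    of radius [q]; if [Y] is its fixed point, [1 - Y] is a square root of
    [1 - B]. *)
Let Y (n : nat) : H -> H :=
  iter n (fun Z x => (2^-1 : R)%:C *: (B x + Z (Z x))) (fun=> 0).

Let YS n x : Y n.+1 x = (2^-1 : R)%:C *: (B x + Y n (Y n x)).
Proof. by []. Qed.

Let bY n : bounded_op (Y n).
Proof.
elim: n => [|n IH]; first exact: bounded_0.
exact: bounded_scale (bounded_add bB (bounded_comp IH IH)).
Qed.

Let lY n : linear (Y n). Proof. exact: bounded_linear. Qed.

Let sY n : symmetric_op (Y n).
Proof.
elim: n => [|n IH] x y; first by rewrite rdot0l rdot0r.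
by rewrite !YS rdotZl rdotZr rdotDl rdotDr sB !IH.
Qed.

Let half_ge0 : 0 <= 2^-1 :> R. Proof. by rewrite invr_ge0. Qed.

Let Yq n x : nrm (Y n x) <= q * nrm x.
Proof.
elim: n x => [|n IH] x; first by rewrite nrm0 mulr_ge0 ?nrm_ge0.
rewrite YS nrmZr //; have h := nrmD (B x) (Y n (Y n x)).
have h1 := le_trans (IH (Y n x)) (ler_wpM2l q0 (IH x)).
have h2 : q * (q * nrm x) <= q * nrm x.
  by rewrite ler_wpM2l // ler_piMl ?nrm_ge0 ?ltW.
have := Bq x; lra.
Qed.

Let Ydiff n x : nrm (Y n.+1 x - Y n x) <= q * nrm x * q ^+ n.
Proof.
elim: n x => [|n IH] x.
  by rewrite expr0 mulr1 [Y 0 x]/= subr0.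
have -> : Y n.+2 x - Y n.+1 x = (2^-1 : R)%:C *:
    (Y n.+1 (Y n.+1 x - Y n x) + (Y n.+1 (Y n x) - Y n (Y n x))).
  rewrite [in LHS]YS [Y n.+1 x in X in _ - X]YS -scalerBr; congr (_ *: _).
  by rewrite (linear_B _ _ (lY n.+1)) addrA subrK opprD addrACA subrr add0r.
rewrite nrmZr //; have h := nrmD (Y n.+1 (Y n.+1 x - Y n x))
   (Y n.+1 (Y n x) - Y n (Y n x)).
have h1 := le_trans (Yq n.+1 (Y n.+1 x - Y n x)) (ler_wpM2l q0 (IH x)).
have qn : 0 <= q * q ^+ n by rewrite mulr_ge0 ?exprn_ge0.
have {}h2 : nrm (Y n.+1 (Y n x) - Y n (Y n x)) <= q * (q * nrm x * q ^+ n).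
  apply: le_trans (IH _) _; rewrite mulrAC [leRHS](_ : _ = q * q ^+ n * (q * nrm x)).
    by rewrite ler_wpM2l.
  by ring.
rewrite exprS.
have -> : q * nrm x * (q * q ^+ n) = q * (q * nrm x * q ^+ n) by ring.
lra.
Qed.

Lemma sqrt_1B : exists S : H -> H,
  positive_op S /\ forall x, S (S x) = x - B x.
Proof.
have /choice[Z ZY] x : exists z : H, Y n x @[n --> \oo] --> z.
  by have [z Yz _] := geometric_cvg q01 (Ydiff ^~ x); exists z.
have lZ : linear Z by exact: linear_lim ZY.
have Zq x : nrm (Z x) <= q * nrm x.
  rewrite -[Z x]subr0; apply: (cvg_nrm_le (N := 0) (ZY x)) => n _.
  by rewrite subr0.
have bZ : bounded_op Z.
  apply/bounded_opP; split=> //; exists (q + 1); first by rewrite ltr_wpDl.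
  move=> x; apply: le_trans (Zq x) _.
  by rewrite ler_wpM2r ?nrm_ge0 // lerDl.
have sZ : symmetric_op Z.
  move=> x y; apply: cvg_unique (rdot_cvgl (ZY x)) _ => //.
  by apply: eq_cvg_seq (rdot_cvgr (ZY y)) => n; rewrite sY.
have ZZ x : Z x = (2^-1 : R)%:C *: (B x + Z (Z x)).
  have YY : Y n (Y n x) @[n --> \oo] --> Z (Z x).
    have -> : Z (Z x) = 0 + Z (Z x) by rewrite add0r.
    have e n : Y n (Y n x - Z x) + Y n (Z x) = Y n (Y n x).
      by rewrite linear_B // subrK.
    apply: eq_cvg_seq e _; apply: cvgD; last exact: ZY.
    apply/cvg_nrmP => e' e0; have /cvg_nrmP/(_ _ e0)[N hN] := ZY x.
    exists N => n /hN; rewrite subr0; apply: le_lt_trans.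
    by apply: le_trans (Yq _ _) _; rewrite ler_piMl ?nrm_ge0 ?ltW.
  have cvS : Y n.+1 x @[n --> \oo] --> Z x.
    by have := ZY x; rewrite -(cvg_shiftS (fun n => Y n x)).
  apply: cvg_unique cvS _ => //.
  by apply: cvgZr; apply: cvgD; [exact: cvg_cst|exact: YY].
pose S x := x - Z x.
have bS : bounded_op S.
  have := bounded_resolvent 1 bZ; congr bounded_op.
  by apply/funext => x; rewrite scale1r.
have sS : symmetric_op S by move=> x y; rewrite rdotBl rdotBr sZ.
have cS x : (1 - q) * nrm x ^+ 2 <= rdot (S x) x.
  rewrite rdotBl rdot_nrm mulrBl mul1r lerD2l lerN2.
  apply: le_trans (rdot_le _ _) _.
  by rewrite expr2 mulrA ler_wpM2r ?nrm_ge0.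
have q10 : 0 < 1 - q by rewrite subr_gt0.
exists S; split; last first.
- move=> x; rewrite /S (linear_B _ _ lZ).
  have e2 : Z x + Z x = B x + Z (Z x).
    have := ZZ x; move: (B x + _) => w ->; rewrite -scalerDl -rmorphD /=.
    by rewrite (_ : 2^-1 + 2^-1 = 1) ?scale1r //; field.
  have -> : B x = Z x + Z x - Z (Z x) by rewrite e2 addrK.
  by rewrite !opprD !opprK !addrA.
- apply: positive_opI => // x; apply: le_trans (cS x).
  by rewrite mulr_ge0 ?exprn_ge0 ?nrm_ge0 // ltW.
Qed.

End SquareRoot.

(** A multiple [t A] is [1 - B] with [B] of norm less than 1. Since
    [op_sqrt] is picked among the positive roots, it is enough to produce
    one. *)
Lemma op_sqrtP H (A : H -> H) : bounded_op A -> symmetric_op A -> coercive A ->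
  positive_op (op_sqrt A) /\ forall x, op_sqrt A (op_sqrt A x) = A x.
Proof.
move=> bA sA cA; have [t [q [t0 q01 Aq]]] := coercive_contraction bA cA.
have sB : symmetric_op (fun x => x - t%:C *: A x).
  by move=> x y; rewrite rdotBl rdotBr rdotZl rdotZr sA.
have [S [pS SS]] := sqrt_1B (bounded_resolvent t%:C bA) sB q01 Aq.
have lS := bounded_linear (positive_bounded pS).
pose r := (Num.sqrt t)^-1.
have r0 : 0 < r by rewrite invr_gt0 sqrtr_gt0.
have [pS' SA] : positive_op (op_sqrt A) /\ op_sqrt A \o op_sqrt A = A.
  apply: (@xgetI _ (fun=> 0) [set S | positive_op S /\ S \o S = A]
    (fun x => r%:C *: S x)); split.
    apply: positive_opI => [|x y|x].
    - exact: bounded_scale (positive_bounded pS).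
    - by rewrite rdotZl rdotZr (positive_symmetric pS).
    - by rewrite rdotZl mulr_ge0 ?(ltW r0) ?positive_rdot_ge0.
  apply/funext => x /=; rewrite linear_Z // SS scalerA -rmorphM /=.
  rewrite opprB addrCA subrr addr0 scalerA -rmorphM /=.
  have -> : r * r * t = 1.
    by rewrite -expr2 exprVn sqr_sqrtr ?(ltW t0) // mulVf // gt_eqF.
  by rewrite scale1r.
by split=> // x; rewrite -[in RHS]SA.
Qed.

End Projection.

(** * Power series and the identity theorem *)

Section PowerSeries.
Variable R : realType.
Local Notation C := R[i].
Local Open Scope complex_scope.

Section Expansion.
Variable E : normedModType C.

Definition power_series_on (c : nat -> E) (r : R) (g : C -> E) : Prop :=
  forall z, cabs z < r -> (\sum_(i < n) z ^+ i *: c i) @[n --> \oo] --> g z.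

Implicit Types (c : nat -> E) (g : C -> E) (r : R).

(** The terms of the convergent series at [r / 2] are bounded. *)
Lemma power_coef_bound c g r : 0 < r -> power_series_on c r g ->
  exists2 k : R, 0 <= k & forall i, (r / 2) ^+ i * nrm (c i) <= k.
Proof.
move=> r0 gc; pose p := r / 2; have p0 : 0 < p by rewrite divr_gt0.
have pr : cabs p%:C < r by rewrite cabs_real gtr0_norm // /p; lra.
have /cvg_nrmP/(_ 1 ltr01)[N hN] := gc _ pr.
have tE i : p ^+ i * nrm (c i) = nrm (p%:C ^+ i *: c i).
  by rewrite nrmZ cabsX cabs_real gtr0_norm.
exists (2 + \sum_(i < N) nrm (p%:C ^+ i *: c i)) => [|i].
  by rewrite addr_ge0 // sumr_ge0 // => i _; exact: nrm_ge0.
rewrite tE; have [Ni|iN] := leqP N i.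
  have h1 := hN i Ni; have h2 := hN i.+1 (leqW Ni).
  have s0 : 0 <= \sum_(i < N) nrm (p%:C ^+ i *: c i).
    by apply: sumr_ge0 => j _; exact: nrm_ge0.
  have := nrm_tri (\sum_(j < i.+1) p%:C ^+ j *: c j) (g p%:C)
    (\sum_(j < i) p%:C ^+ j *: c j).
  rewrite {1}big_ord_recr /= addrAC subrr add0r.
  rewrite (nrmBC (g _)) => h3; lra.
rewrite (bigD1 (Ordinal iN)) //= addrCA lerDl addr_ge0 //.
by apply: sumr_ge0 => j _; exact: nrm_ge0.
Qed.

(** Near the centre the tail is dominated by a geometric series of ratio at
    most 1/2. Order 0 says that [g] is locally bounded; order [n + 1] isolates
    the [n]-th coefficient. *)
Lemma taylor_remainder c g r n : 0 < r -> power_series_on c r g ->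
  exists k p : R, [/\ 0 <= k, 0 < p &
  forall z, cabs z < p ->
    nrm (g z - \sum_(i < n) z ^+ i *: c i) <= k * cabs z ^+ n].
Proof.
move=> r0 gc; have [k k0 ck] := power_coef_bound r0 gc; set p := r / 2 in ck.
have p0 : 0 < p by rewrite divr_gt0.
exists (2 * k / p ^+ n), (p / 2); split.
- by rewrite mulr_ge0 ?invr_ge0 ?exprn_ge0 ?mulr_ge0 // ltW.
- by rewrite divr_gt0.
move=> z zp; pose x := cabs z / p.
have x0 : 0 <= x by rewrite divr_ge0 ?cabs_ge0 // ltW.
have x1 : x <= 2^-1 by rewrite ler_pdivrMr // mulrC ltW.
have term i : nrm (z ^+ i *: c i) <= k * x ^+ i.
  rewrite nrmZ cabsX (_ : cabs z = x * p); last first.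
    by rewrite divfK // gt_eqF.
  by rewrite exprMn -mulrA mulrC ler_wpM2r ?exprn_ge0.
have tail m : nrm (\sum_(i < n + m) z ^+ i *: c i - \sum_(i < n) z ^+ i *: c i)
    <= k * x ^+ n * (2 - 2 * 2^-1 ^+ m).
  elim: m => [|m IH].
    by rewrite addn0 subrr nrm0 expr0 mulr1 subrr mulr0.
  rewrite addnS big_ord_recr /= addrAC; apply: le_trans (nrmD _ _) _.
  apply: le_trans (lerD IH (term _)) _; rewrite exprD.
  have hm : x ^+ m <= 2^-1 ^+ m by rewrite lerXn2r // nnegrE invr_ge0.
  have := ler_wpM2l (mulr_ge0 k0 (exprn_ge0 n x0)) hm.
  rewrite exprS; move: (2^-1 ^+ m : R) (x ^+ m) (x ^+ n) => a b d h.
  have -> : 2 - 2 * (2^-1 * a) = 2 - a by field.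
  have -> : k * (d * b) = k * d * b by ring.
  have -> : k * d * (2 - 2 * a) = k * d * 2 - 2 * (k * d * a) by ring.
  have -> : k * d * (2 - a) = k * d * 2 - k * d * a by ring.
  lra.
have -> : 2 * k / p ^+ n * cabs z ^+ n = k * x ^+ n * 2.
  by rewrite /x (expr_div_n (cabs z) p); ring.
have zr : cabs z < r by apply: lt_trans zp _; rewrite /p; lra.
apply: (cvg_nrm_le (N := n) (gc _ zr)) => m nm.
rewrite -(subnKC nm); apply: le_trans (tail _) _.
rewrite ler_wpM2l ?mulr_ge0 ?exprn_ge0 // gerDl oppr_le0.
by rewrite mulr_ge0 ?exprn_ge0 ?invr_ge0.
Qed.

(** By induction on [n], the remainder of order [n + 1] compares [c n] with
    [g z / z ^ n]. The hypothesis allows both a flat zero of [g] and zeros of [g]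
    accumulating at the centre. *)
Lemma power_series_flat c g r : 0 < r -> power_series_on c r g ->
  (forall n (e : R), 0 < e ->
     exists z, [/\ z != 0, cabs z < e & nrm (g z) <= e * cabs z ^+ n]) ->
  forall n, c n = 0.
Proof.
move=> r0 gc flat n; elim/ltn_ind: n => n IH.
have [k [p [k0 p0 kp]]] := taylor_remainder n.+1 r0 gc.
apply: nrm_small => e e0.
pose d := Num.min p (e / (1 + k)).
have k1 : 0 < 1 + k by rewrite ltr_pwDl.
have d0 : 0 < d by rewrite lt_min p0 divr_gt0.
have [z [z0 zd gz]] := flat n d d0.
have zp : cabs z < p by apply: lt_le_trans zd _; rewrite ge_min lexx.
have de : d * (1 + k) <= e by rewrite -ler_pdivlMr // ge_min lexx orbT.
have := kp z zp.
rewrite big_ord_recr /= big1 ?add0r => [|i _]; last by rewrite IH ?scaler0.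
move=> h.
have zn0 : 0 < cabs z ^+ n by rewrite exprn_gt0 // cabs_gt0.
rewrite -(ler_pM2r zn0) mulrC -cabsX -nrmZ.
have h1 : nrm (z ^+ n *: c n) <= nrm (g z) + k * cabs z ^+ n.+1.
  rewrite -[_ *: _](subKr (g z)); apply: le_trans (nrmD _ _) _.
  by rewrite nrmN lerD2l.
apply: le_trans h1 _.
apply: le_trans (lerD gz _ : _ <= _ + k * (d * cabs z ^+ n)) _.
  by rewrite exprS ler_wpM2l // ler_wpM2r ?ltW.
rewrite cabsX; apply: le_trans (_ : d * (1 + k) * cabs z ^+ n <= _).
  by rewrite le_eqVlt; apply/orP; left; apply/eqP; ring.
by rewrite ler_wpM2r // ltW.
Qed.

Lemma power_series_0 c g r z : power_series_on c r g -> cabs z < r ->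
  (forall n, c n = 0) -> g z = 0.
Proof.
move=> gc zr c0; apply: cvg_unique (gc _ zr) _ => //.
apply: eq_cvg_seq (cvg_cst 0) => n.
by rewrite big1 // => i _; rewrite c0 scaler0.
Qed.

End Expansion.

Variable E : normedModType C.
Implicit Types (X : set C) (f : C -> E).

Lemma analytic_expansion X f a : analytic_on X f -> X a ->
  exists (c : nat -> E) (r : R), 0 < r /\ forall z, cabs z < r ->
    X (a + z) /\ (\sum_(i < n) z ^+ i *: c i) @[n --> \oo] --> f (a + z).
Proof.
move=> fX Xa; have [c [r [r0 cr]]] := fX a Xa; exists c, (complex.Re r).
split=> [|z zr]; first by rewrite -ltcR -ge0_ReK // ltW.
have := cr (a + z); rewrite addrAC subrr add0r; apply.
by rewrite cabsE (ge0_ReK (ltW r0)) ltcR.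
Qed.

Lemma unit_discE (z : C) : unit_disc z = (cabs z < 1) :> Prop.
Proof. by rewrite /unit_disc /= cabsE -(rmorph1 (real_complex R)) ltcR. Qed.

(** Vanishing propagates along the segment from 0 to [a]: at the last point
    reached, the zeros before it accumulate, so the power series there is 0. *)
Lemma identity_theorem_disc f (p : R) : analytic_on unit_disc f ->
  0 < p -> (forall z, cabs z < p -> f z = 0) ->
  forall a, unit_disc a -> f a = 0.
Proof.
move=> fA p0 fp a; rewrite unit_discE => a1.
have [->|aN0] := eqVneq a 0; first by apply: fp; rewrite cabs0.
have ap : 0 < cabs a by exact: cabs_gt0.
pose A := [set t : R | 0 <= t <= 1 /\
  forall s : R, 0 <= s <= t -> f (s%:C * a) = 0].
have A0 : A 0.
  split=> [|s /andP[s0 s0']]; first by rewrite lexx ler01.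
  have -> : s = 0 by apply/eqP; rewrite eq_le s0 s0'.
  by rewrite mul0r; apply: fp; rewrite cabs0.
have supA : has_sup A.
  by split; [exists 0|exists 1 => t [/andP[]]].
set T := sup A.
have T1 : T <= 1 by apply: ge_sup; [exists 0|move=> t [/andP[]]].
have leT t : A t -> t <= T by move=> At; apply: ub_le_sup => //; case: supA.
have fT s : 0 <= s < T -> f (s%:C * a) = 0.
  move=> /andP[s0 sT]; have [|t [_ tA] ht] := @sup_adherent _ A (T - s) _ supA.
    by rewrite subr_gt0.
  by apply: tA; rewrite s0 ltW //; move: ht; rewrite -/T opprB addrCA subrr addr0.
have Tp : 0 < T.
  apply: (@lt_le_trans _ _ (Num.min (p / 2) 1)).
    by rewrite lt_min ltr01 divr_gt0.
  apply: leT; split; first by rewrite ge_min lexx orbT le_min ler01 divr_ge0 // ltW.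
  move=> s /andP[s0]; rewrite le_min => /andP[sp s1]; apply: fp.
  rewrite cabsM cabs_real ger0_norm //.
  have : s * cabs a <= s * 1 by rewrite ler_wpM2l // ltW.
  lra.
have TD : unit_disc (T%:C * a).
  rewrite unit_discE cabsM cabs_real gtr0_norm //.
  by apply: le_lt_trans a1; rewrite ler_piMl // ltW.
have [c [r [r0 cr]]] := analytic_expansion fA TD.
have c0 : forall n, c n = 0.
  apply: (power_series_flat (g := fun z => f (T%:C * a + z)) r0) => [z zr|n e e0].
    by case: (cr z zr).
  pose d := Num.min (e / 2) T.
  have d0 : 0 < d by rewrite lt_min Tp divr_gt0.
  have dT : d <= T by rewrite ge_min lexx orbT.
  have de : d <= e / 2 by rewrite ge_min lexx.
  exists ((- d)%:C * a); split.
  - by rewrite mulf_neq0 // fmorph_eq0 oppr_eq0 gt_eqF.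
  - rewrite cabsM cabs_real normrN gtr0_norm //.
    have : d * cabs a <= d * 1 by rewrite ler_wpM2l // ltW.
    lra.
  - rewrite -mulrDl -rmorphD fT ?nrm0; last first.
      by rewrite subr_ge0 dT ltrBlDr ltrDl.
    by rewrite mulr_ge0 ?exprn_ge0 ?cabs_ge0 // ltW.
have fr z : cabs z < r -> f (T%:C * a + z) = 0.
  move=> zr; apply: (power_series_0 (g := fun z => f (T%:C * a + z)) _ zr c0).
  by move=> w /cr[].
have fTr s : T <= s <= T + r / 2 -> f (s%:C * a) = 0.
  move=> /andP[Ts sr]; have -> : s%:C * a = T%:C * a + (s - T)%:C * a.
    by rewrite -mulrDl -rmorphD addrC subrK.
  apply: fr; rewrite cabsM cabs_real ger0_norm ?subr_ge0 //.
  have : (s - T) * cabs a <= (s - T) * 1 by rewrite ler_wpM2l ?subr_ge0 // ltW.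
  lra.
have T1' : 1 <= T.
  rewrite leNgt; apply/negP => Tlt.
  have : A (Num.min 1 (T + r / 2)).
    split; first by rewrite ge_min lexx le_min ler01 /= addr_ge0 ?divr_ge0 // ltW.
    move=> s /andP[s0]; rewrite le_min => /andP[s1 sr].
    by have [sT|Ts] := ltP s T; [apply: fT; rewrite s0|apply: fTr; rewrite Ts].
  move=> /leT; rewrite leNgt lt_min Tlt ltrDl divr_gt0 //.
have -> : a = 1%:C * a by rewrite rmorph1 mul1r.
by apply: fTr; rewrite T1 /=; lra.
Qed.

End PowerSeries.

(** * Unitaries from Gram matrices *)

Section GramUnitary.
Variable R : realType.
Local Notation C := R[i].
Local Open Scope complex_scope.
Implicit Types H K : hilbertType R.

Lemma hdot_lim_eq H K (u : nat -> H) (v : nat -> K) x y z w :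
  u n @[n --> \oo] --> x -> v n @[n --> \oo] --> y ->
  (forall n, hdot (u n) z = hdot (v n) w) -> hdot x z = hdot y w.
Proof.
move=> ux vy uv; have uv' n := uv n; rewrite !hdotE; congr (_ +i* _).
  apply: cvg_unique (rdot_cvgl ux) _ => //.
  apply: eq_cvg_seq (rdot_cvgl vy) => n.
  by rewrite /rdot uv.
apply: cvg_unique (rdot_cvgl ux) _ => //.
apply: eq_cvg_seq (rdot_cvgl vy) => n.
by have := uv' n; rewrite !hdotE => -[].
Qed.

Definition total_family H (I : Type) (a : I -> H) : Prop :=
  forall h, (forall i, hdot h (a i) = 0) -> h = 0.

(** Linear relations among the [a i] may fail for the [b i], so the span of
    the pairs is a relation; equality of the Gram matrices makes it an
    isometry. *)
Inductive span_graph H K (I : Type) (a : I -> H) (b : I -> K) : H -> K -> Prop :=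
| span_graph0 : span_graph a b 0 0
| span_graphD c i x u : span_graph a b x u ->
    span_graph a b (c *: a i + x) (c *: b i + u).

Section Graph.
Variables (H K : hilbertType R) (I : Type) (a : I -> H) (b : I -> K).
Local Notation graph := (span_graph a b).

Lemma span_graph_lin c x u y v :
  graph x u -> graph y v -> graph (c *: x + y) (c *: u + v).
Proof.
move=> xu yv; elim: xu => [|d i {}x {}u _ IH]; first by rewrite !scaler0 !add0r.
by rewrite !scalerDr !scalerA -!addrA; apply: span_graphD.
Qed.

Lemma span_graph_dot h k x u : (forall i, hdot k (b i) = hdot h (a i)) ->
  graph x u -> hdot u k = hdot x h.
Proof.
move=> kh; elim=> [|c i {}x {}u _ IH]; first by rewrite !hdot0l.
by rewrite !hdotDl !hdotZl IH hdotC kh -hdotC.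
Qed.

Hypothesis ab : forall i j, hdot (a i) (a j) = hdot (b i) (b j).

Lemma span_graph_isometry x u y v : graph x u -> graph y v ->
  hdot u v = hdot x y.
Proof.
move=> xu yv; apply: span_graph_dot xu => i.
by elim: yv => [|c j {}y {}v _ IH]; rewrite ?hdot0l // !hdotDl !hdotZl IH ab.
Qed.

Hypothesis ta : total_family a.

(** Vectors of the span that converge to [h] have partners that form a Cauchy
    sequence, by isometry. *)
Lemma gram_transfer h : exists k (x : nat -> H) (u : nat -> K),
  [/\ forall n, graph (x n) (u n), x n @[n --> \oo] --> h,
      u n @[n --> \oo] --> k & forall i, hdot k (b i) = hdot h (a i)].
Proof.
pose D := [set x | exists u, graph x u].
have lD : linear_set D.
  split=> [|c x y [u xu] [v yv]]; first by exists 0; exact: span_graph0.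
  by exists (c *: u + v); exact: span_graph_lin.
have [|x /choice[u xu] xh] := dense_linear_set lD _ h.
  move=> g gD; apply: ta => i; apply: gD; exists (1 *: b i + 0).
  by rewrite -[a i]scale1r -[_ *: _]addr0; apply/span_graphD/span_graph0.
have iso m n : nrm (u m - u n) = nrm (x m - x n).
  have g : graph (x m - x n) (u m - u n).
    rewrite [x m - _]addrC [u m - _]addrC -(scaleN1r (x n)) -(scaleN1r (u n)).
    exact: span_graph_lin.
  apply/eqP; rewrite -(eqrXn2 (n := 2)) ?nrm_ge0 //; apply/eqP.
  by rewrite -!rdot_nrm /rdot (span_graph_isometry g g).
have [k uk] : exists k : K, u n @[n --> \oo] --> k.
  apply: cauchy_nrm => e e0; have e2 : 0 < e / 2 by rewrite divr_gt0.
  have /cvg_nrmP/(_ _ e2)[N hN] := xh.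
  exists N => m n /hN hm /hN hn; rewrite iso.
  have := nrm_tri (x m) h (x n); rewrite (nrmBC h) => h3; lra.
exists k, x, u; split=> // i.
apply: hdot_lim_eq uk xh _ => n; apply: span_graph_dot (xu n) => j.
by rewrite ab.
Qed.

End Graph.

(** [U h] is the vector that has the same inner products with the [b i] as
    [h] has with the [a i]; surjectivity is the symmetric construction. *)
Lemma gram_unitary H K (I : Type) (a : I -> H) (b : I -> K) :
  (forall i j, hdot (a i) (a j) = hdot (b i) (b j)) ->
  total_family a -> total_family b ->
  exists U : H -> K, [/\ linear U, forall x y, hdot (U x) (U y) = hdot x y,
    forall y, exists x, U x = y & forall h i, hdot (U h) (b i) = hdot h (a i)].
Proof.
move=> ab ta tb.
have uniqb k k' : (forall i, hdot k (b i) = hdot k' (b i)) -> k = k'.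
  move=> kk; apply/eqP; rewrite -subr_eq0; apply/eqP/tb => i.
  by rewrite hdotBl kk subrr.
have /choice[U UP] h : exists k, forall i, hdot k (b i) = hdot h (a i).
  by have [k [x [u [_ _ _ kh]]]] := gram_transfer ab ta h; exists k.
exists U; split=> // [c x y|x y|k].
- by apply: uniqb => i; rewrite hdotDl hdotZl !UP hdotDl hdotZl.
- have [k [u [v [uv ux vk kP]]]] := gram_transfer ab ta x.
  have -> : U x = k by apply: uniqb => i; rewrite UP kP.
  by apply: hdot_lim_eq vk ux _ => n; apply: span_graph_dot (uv n) => i.
- have [h [_ [_ [_ _ _ hk]]]] := gram_transfer (fun i j => esym (ab i j)) tb k.
  by exists h; apply: uniqb => i; rewrite UP hk.
Qed.

End GramUnitary.

(** * Resolvents and the spectral radius *)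

Section Resolvent.
Variable R : realType.
Local Notation C := R[i].
Local Open Scope complex_scope.
Variable H : hilbertType R.
Implicit Types (L A : H -> H) (z : C).

Lemma iter_scale A z n x : linear A ->
  iter n (fun y => z *: A y) x = z ^+ n *: iter n A x.
Proof.
move=> lA; elim: n => [|n IH]; first by rewrite scale1r.
by rewrite /= IH linear_Z // scalerA exprS.
Qed.

(** The factorization [1 - (a + z) L = (1 - a L) (1 - z Ra L)] reduces the
    expansion to a Neumann series in [z]. *)
Lemma resolvent_expansion L a Ra : bounded_op L ->
  is_inverse (fun x => x - a *: L x) Ra ->
  exists2 p : R, 0 < p & forall z, cabs z < p -> forall h,
    (\sum_(i < n) z ^+ i *: iter i (Ra \o L) (Ra h)) @[n --> \oo]
      --> op_inv (fun x => x - (a + z) *: L x) h.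
Proof.
move=> bL iRa; have bR := bounded_inverse iRa.
have bA := bounded_comp bR bL.
have /bounded_opP[lA [k k0 Ak]] := bA.
exists (k^-1 / 2) => [|z zp h]; first by rewrite divr_gt0 // invr_gt0.
have half : 0 <= (2^-1 : R) < 1 by rewrite invr_ge0 ler0n invf_lt1 // ltr1n.
have [||S iS Ssum] := @neumann _ H (fun x => z *: (Ra \o L) x) 2^-1 _ half.
- exact: bounded_linear (bounded_scale z bA).
- move=> x; rewrite nrmZ; apply: le_trans (ler_wpM2l (cabs_ge0 z) (Ak x)) _.
  rewrite mulrA ler_wpM2r ?nrm_ge0 // -ler_pdivlMr // mulrC ltW //.
rewrite (op_inv_unique (S := S \o Ra)).
  by apply: eq_cvg_seq (Ssum (Ra h)) => n; apply: eq_bigr => i _;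
    exact: iter_scale.
have := is_inverse_comp iRa iS; congr is_inverse; apply/funext => x /=.
rewrite (linear_B _ _ (bounded_linear bL)) (linear_Z _ _ (bounded_linear bL)).
have e : z *: L x = z *: Ra (L x) - (z * a) *: L (Ra (L x)).
  by rewrite -[in LHS](is_inverseVK iRa (L x)) scalerBr scalerA.
rewrite scalerDl e scalerBr scalerA (mulrC a) !opprD !opprK !addrA.
by congr (_ + _); rewrite addrAC.
Qed.

(** Beyond a bound of [L] the resolvent is a Neumann series. It is boundedness
    that makes the supremum [spectral_radius] an upper bound of the moduli. *)
Lemma spectrum_bounded L : bounded_op L ->
  exists k : R, forall l, spectrum L l -> cabs l <= k.
Proof.
move=> bL; have /bounded_opP[lL [k k0 Lk]] := bL.
exists k => l; apply: contra_notP => /negP; rewrite -ltNge => kl.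
have l0 : 0 < cabs l by apply: lt_trans kl.
have lN0 : l != 0 by apply/eqP => le0; rewrite le0 cabs0 ltxx in l0.
have q01 : 0 <= k / cabs l < 1.
  by rewrite divr_ge0 ?cabs_ge0 ?(ltW k0) //= ltr_pdivrMr // mul1r.
have [||S iS _] := @neumann _ H (fun x => l^-1 *: L x) (k / cabs l) _ q01.
- exact: bounded_linear (bounded_scale l^-1 bL).
- by move=> x; rewrite nrmZ cabsV mulrC mulrAC ler_wpM2r ?invr_ge0 ?cabs_ge0.
exists (fun x => l^-1 *: S x).
have lS := bounded_linear (bounded_inverse iS).
have Te x : l *: x - L x = l *: (x - l^-1 *: L x).
  by rewrite scalerBr scalerA mulfV // scale1r.
apply: is_inverseI => [|x|x].
- exact: bounded_scale (bounded_inverse iS).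
- by rewrite Te (linear_Z _ _ lS) (is_inverseK iS) scalerA mulVf // scale1r.
- rewrite scalerA mulfV // scale1r (linear_Z _ _ lL).
  exact: (is_inverseVK iS x).
Qed.

Lemma spectral_radius_ub L l : bounded_op L -> spectrum L l ->
  cabs l <= spectral_radius L.
Proof.
move=> bL Ll; apply: ub_le_sup; last by exists l.
by have [k Lk] := spectrum_bounded bL; exists k => _ [m Lm <-]; exact: Lk.
Qed.

(** Away from 0, [1 / z] has modulus larger than the spectral radius, hence
    lies outside the spectrum. *)
Lemma resolvent_exists L z : bounded_op L -> cabs z * spectral_radius L < 1 ->
  exists S, is_inverse (fun x => x - z *: L x) S.
Proof.
move=> bL zr; have [->|z0] := eqVneq z 0.
  exists id; apply: is_inverseI => [|x|x]; first exact: bounded_id.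
  - by rewrite scale0r subr0.
  - by rewrite scale0r subr0.
have zp := cabs_gt0 z0.
have : ~ spectrum L z^-1.
  move=> /(spectral_radius_ub bL); rewrite cabsV => /(ler_wpM2l (ltW zp)).
  by rewrite mulfV ?gt_eqF // leNgt zr.
move=> /contrapT[S iS]; have lS := bounded_linear (bounded_inverse iS).
exists (fun x => z^-1 *: S x).
have Te x : x - z *: L x = z *: (z^-1 *: x - L x).
  by rewrite scalerBr scalerA mulfV // scale1r.
apply: is_inverseI => [|x|x].
- exact: bounded_scale (bounded_inverse iS).
- by rewrite Te (linear_Z _ _ lS) (is_inverseK iS) scalerA mulVf // scale1r.
- rewrite Te -(linear_Z _ _ lS) (is_inverseVK iS) scalerA mulfV //.
  by rewrite scale1r.
Qed.

Lemma spectral_disc_open L a : cabs a * spectral_radius L < 1 ->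
  exists2 p : R, 0 < p &
    forall z, cabs z < p -> cabs (a + z) * spectral_radius L < 1.
Proof.
move: (spectral_radius L) => r ar; have [r0|r0] := leP r 0.
  exists 1 => // z _; apply: le_lt_trans ltr01.
  by rewrite mulr_ge0_le0 ?cabs_ge0.
exists ((1 - cabs a * r) / r) => [|z]; first by rewrite divr_gt0 // subr_gt0.
rewrite ltr_pdivlMr // => zr.
have := ler_wpM2r (ltW r0) (cabsD a z); rewrite mulrDl; lra.
Qed.

End Resolvent.

(** * The analytic model of a left-invertible operator *)

Section Model.
Variable R : realType.
Local Notation C := R[i].

Lemma analytic_onI (E : normedModType C) (X : set C) (g : C -> E) :
  (forall a, X a -> exists (c : nat -> E) (p : R), 0 < p /\
     forall z, cabs z < p -> X (a + z) /\
       (\sum_(i < n) z ^+ i *: c i) @[n --> \oo] --> g (a + z)) ->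
  analytic_on X g.
Proof.
move=> gX a /gX[c [p [p0 cp]]]; exists c, p%:C%C.
split=> [|z]; first by rewrite ltcR.
by rewrite cabsE ltcR => /cp; rewrite addrC subrK.
Qed.

(** [W] is the orthogonal complement of the range of [T], and the hypothesis
    [WTL] singles out, among the left inverses of [T], the one that vanishes on
    [W]. *)
Variables (H : hilbertType R) (T L : H -> H) (W : set H).
Hypotheses (bT : bounded_op T) (bL : bounded_op L).
Hypothesis LT : cancel T L.
Hypothesis WE : forall x, W x <-> forall y, hdot (T y) x = 0.
Hypothesis WTL : forall x, W (x - T (L x)).

Let linW a x y : W x -> W y -> W (a *: x + y).
Proof.
move=> /WE Wx /WE Wy; apply/WE => z.
by rewrite hdotDr hdotZr Wx Wy mulr0 addr0.
Qed.

Let W_eq0 x : W x -> (forall w, W w -> hdot x w = 0) -> x = 0.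
Proof. by move=> Wx xW; apply: hdotxx_eq0; exact: xW. Qed.

Let W_inj x y : W x -> W y -> (forall w, W w -> hdot x w = hdot y w) -> x = y.
Proof.
move=> Wx Wy xy; apply/eqP; rewrite -subr_eq0; apply/eqP/W_eq0.
  by rewrite addrC -scaleN1r; exact: linW.
by move=> w Ww; rewrite hdotBl xy // subrr.
Qed.

(** [T L] is the orthogonal projection onto the range of [T]. *)
Lemma oproj_left_inverse x : oproj W x = x - T (L x).
Proof.
apply: xget_unique => [|p [Wp pW]].
  split; first exact: WTL.
  by move=> w /WE Ww; rewrite opprB addrCA subrr addr0.
apply: W_inj => // w Ww; apply/eqP; rewrite -subr_eq0 -hdotBl.
have -> : p - (x - T (L x)) = T (L x) - (x - p).
  by rewrite !opprB addrCA.
by move/WE: (Ww) => wT; rewrite hdotBl wT pW // subrr.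
Qed.

Let P := oproj W.

Let W_P x : W (P x). Proof. by rewrite /P oproj_left_inverse. Qed.

Let bP : bounded_op P.
Proof.
have := bounded_resolvent 1 (bounded_comp bT bL); congr bounded_op.
by apply/funext => x; rewrite /P oproj_left_inverse scale1r.
Qed.

Let PT x : P (T x) = 0.
Proof. by rewrite /P oproj_left_inverse LT subrr. Qed.

Let hdotP x w : W w -> hdot (P x) w = hdot x w.
Proof.
by move=> /WE Ww; rewrite /P oproj_left_inverse hdotBl Ww subr0.
Qed.

Definition spectral_disc : set C :=
  [set z : C | complex.Re `|z| * spectral_radius L < 1].

Definition resolvent (z : C) : H -> H := op_inv (fun x => x - z *: L x).

Definition co_resolvent (w : C) : H -> H :=
  op_inv (fun x => x - w^* *: adjoint L x).

(** With this evaluation map, [H] itself is a space of [W]-valued functions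
    that realizes the model. *)
Definition model_eval (h : H) (z : C) : H := P (resolvent z h).

Definition model_kernel (z w : C) : H -> H :=
  oproj W \o op_inv (fun x => x - z *: L x)
          \o op_inv (fun x => x - w^* *: adjoint L x).

Let iR z : spectral_disc z -> is_inverse (fun x => x - z *: L x) (resolvent z).
Proof. by move=> Oz; apply/op_invP/resolvent_exists. Qed.

Let bR z : spectral_disc z -> bounded_op (resolvent z).
Proof. by move=> /iR/bounded_inverse. Qed.

Lemma co_resolventE w : spectral_disc w -> co_resolvent w = adjoint (resolvent w).
Proof.
move=> Ow; have bw : bounded_op (fun x => x - w *: L x).
  exact: bounded_resolvent.
apply: op_inv_unique.
have := is_inverse_adjoint bw (iR Ow); congr is_inverse.
apply: adjoint_unique; first exact/bounded_resolvent/bounded_adjoint.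
move=> x y; rewrite hdotBl hdotBr hdotZl hdotZr hdot_adjr //.
by rewrite conjcK.
Qed.

Let bS w : spectral_disc w -> bounded_op (co_resolvent w).
Proof. by move=> Ow; rewrite co_resolventE //; exact/bounded_adjoint/bR. Qed.

(** Since [resolvent w] has adjoint [co_resolvent w], the kernel function of [w]
    and [x] in this realization is [co_resolvent w x]. *)
Lemma model_eval_dot w h x : spectral_disc w -> W x ->
  hdot (model_eval h w) x = hdot h (co_resolvent w x).
Proof.
by move=> Ow Wx; rewrite hdotP // co_resolventE // hdot_adjr //; exact: bR.
Qed.

Lemma model_eval_linear a h g z : spectral_disc z ->
  model_eval (a *: h + g) z = a *: model_eval h z + model_eval g z.
Proof.
move=> /bR /bounded_linear lR.
by rewrite /model_eval lR (bounded_linear bP).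
Qed.

(** [(1 - z L) ^-1 T = T + z (1 - z L) ^-1] because [L T = 1], and [P T = 0]. *)
Lemma model_eval_shift h z : spectral_disc z ->
  model_eval (T h) z = z *: model_eval h z.
Proof.
move=> Oz; have lL := bounded_linear bL; rewrite /model_eval.
have e : h + z *: L (resolvent z h) = resolvent z h.
  by rewrite -[h in h + _](is_inverseVK (iR Oz)) subrK.
have -> : resolvent z (T h) = T h + z *: resolvent z h.
  rewrite -[RHS](is_inverseK (iR Oz)); congr (resolvent z _).
  by rewrite (linear_D _ _ lL) LT (linear_Z _ _ lL) e addrK.
by rewrite (linear_D _ _ (bounded_linear bP)) PT add0r
  (linear_Z _ _ (bounded_linear bP)).
Qed.

Lemma model_eval_analytic h : analytic_on spectral_disc (model_eval h).
Proof.
apply: analytic_onI => a Oa.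
have [p p0 pE] := resolvent_expansion bL (iR Oa).
have [r r0 rO] := spectral_disc_open Oa.
exists (fun i => P (iter i (resolvent a \o L) (resolvent a h))), (Num.min p r).
split=> [|z]; first by rewrite lt_min p0.
rewrite lt_min => /andP[zp zr]; split; first exact: rO.
apply: eq_cvg_seq (bounded_cvg bP (pE z zp h)) => n.
rewrite (linear_sum_ord _ (bounded_linear bP)); apply: eq_bigr => i _.
by rewrite (linear_Z _ _ (bounded_linear bP)).
Qed.

Let O0 : spectral_disc 0.
Proof.
have : cabs (0 : C) * spectral_radius L < 1 by rewrite cabs0 mul0r ltr01.
by [].
Qed.

(** The Taylor coefficients of [model_eval h] at 0 are the [P (L ^ n h)]; when
    they vanish, [h = T (L h) = T ^ 2 (L ^ 2 h) = ...]. *)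
Lemma model_eval_inj h :
  (forall x, (forall n, exists y, x = iter n T y) -> x = 0) ->
  (forall z, spectral_disc z -> model_eval h z = 0) -> h = 0.
Proof.
move=> pure h0; have i0 : is_inverse (fun x => x - 0 *: L x) id.
  by apply: is_inverseI => [|x|x]; rewrite ?scale0r ?subr0 //; exact: bounded_id.
have [p p0 pE] := resolvent_expansion bL i0.
have [r r0 rO] := spectral_disc_open O0.
have c0 : forall n, P (iter n L h) = 0.
  have m0 : 0 < Num.min p r by rewrite lt_min p0.
  apply: (power_series_flat (g := model_eval h) m0) => [z|n e e0].
    rewrite lt_min => /andP[zp zr].
    have := bounded_cvg bP (pE z zp h); rewrite add0r => cv.
    apply: eq_cvg_seq cv => n.
    rewrite (linear_sum_ord _ (bounded_linear bP)); apply: eq_bigr => i _.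
    by rewrite (linear_Z _ _ (bounded_linear bP)).
  pose t := Num.min (e / 2) (r / 2).
  have t0 : 0 < t by rewrite lt_min !divr_gt0.
  exists t%:C%C; split.
  - by rewrite fmorph_eq0 gt_eqF.
  - rewrite cabs_real gtr0_norm //; apply: (@le_lt_trans _ _ (e / 2)).
      by rewrite ge_min lexx.
    lra.
  - rewrite h0 ?nrm0; first by rewrite mulr_ge0 ?exprn_ge0 ?cabs_ge0 ?(ltW e0).
    have := rO t%:C%C; rewrite add0r; apply.
    rewrite cabs_real gtr0_norm //; apply: (@le_lt_trans _ _ (r / 2)).
      by rewrite ge_min lexx orbT.
    lra.
apply: pure => n; exists (iter n L h).
elim: n => [//|n IH]; rewrite iterSr.
have := c0 n; rewrite /P oproj_left_inverse => /eqP; rewrite subr_eq0 => /eqP e.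
by rewrite /= -e.
Qed.

Lemma model_kernel_analytic : analytic_op_kernel W spectral_disc model_kernel.
Proof.
have kE z w x : model_kernel z w x = model_eval (co_resolvent w x) z by [].
split=> [z w Oz Ow|n z x Oz Wx|w x Ow Wx]; last exact: model_eval_analytic.
- have bk : bounded_op (model_kernel z w).
    exact: bounded_comp (bounded_comp bP (bR Oz)) (bS Ow).
  split=> [x _|a x y _ _|]; first exact: W_P.
    exact: (bounded_linear bk).
  by case: bk => _ [c kc]; exists c.
- (* the quadratic form of the kernel is a square *)
  pose s := \sum_i co_resolvent (z i) (x i).
  have -> : \sum_i \sum_j hdot (model_kernel (z i) (z j) (x j)) (x i) = hdot s s.
    rewrite hdot_sumr; apply: eq_bigr => i _; rewrite hdot_suml.
    by apply: eq_bigr => j _; rewrite kE model_eval_dot.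
  by rewrite hdot_nrm ler0c exprn_ge0 ?nrm_ge0.
Qed.

(** Purity, that the ranges of the powers of [T] meet in 0 only, makes the
    evaluation injective. *)
Hypothesis pure : forall x, (forall n, exists y, x = iter n T y) -> x = 0.

Lemma model_rkhs : is_op_rkhs W spectral_disc model_kernel model_eval.
Proof.
split=> [|h z Oz|w x Ow Wx]; last 1 first.
- by exists (co_resolvent w x); split=> // h; exact: model_eval_dot.
- split=> [a h g z Oz|h h0|h].
  + exact: model_eval_linear.
  + exact: model_eval_inj.
  + exact: model_eval_analytic.
- exact: W_P.
Qed.

(** The reproducing property determines the Gram matrix of the kernel
    functions, which are total in [H] and in [K]; the resulting unitary
    commutes with evaluation, and so it carries [T] to the shift. *)
Lemma model_unitary (K : hilbertType R) (evk : K -> C -> H) :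
  is_op_rkhs W spectral_disc model_kernel evk ->
  exists2 Mt : K -> K, is_shift spectral_disc evk Mt &
    unitarily_equivalent T Mt.
Proof.
move=> [[evlin evinj _] evW evker].
pose I := {p : C * H | spectral_disc p.1 /\ W p.2}.
pose a (i : I) := co_resolvent (sval i).1 (sval i).2.
have /choice[b bP'] (i : I) : exists k : K,
    (forall z, spectral_disc z -> evk k z = model_eval (a i) z) /\
    (forall g, hdot (evk g (sval i).1) (sval i).2 = hdot g k).
  by case: i => -[w x] [/= Ow Wx]; have [k kP] := evker w x Ow Wx; exists k.
have ab i j : hdot (a i) (a j) = hdot (b i) (b j).
  have [Oj Wj] := svalP j; have [Oi Wi] := svalP i.
  case: (bP' j) => _ <-; case: (bP' i) => -> // _.
  by rewrite model_eval_dot.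
have ta : total_family a.
  move=> h ha; apply: model_eval_inj => // z Oz; apply: W_eq0 => [|x Wx].
    exact: W_P.
  by rewrite model_eval_dot //; exact: (ha (exist _ (z, x) (conj Oz Wx))).
have tb : total_family b.
  move=> k kb; apply: evinj => z Oz; apply: W_eq0 => [|x Wx].
    exact: evW.
  pose i : I := exist _ (z, x) (conj Oz Wx).
  have [_ bi] := bP' i; exact: etrans (bi k) (kb i).
have [U [lU isoU surU UP]] := gram_unitary ab ta tb.
have evU h z : spectral_disc z -> evk (U h) z = model_eval h z.
  move=> Oz; apply: W_inj => [||x Wx]; [exact: evW|exact: W_P|].
  pose i : I := exist _ (z, x) (conj Oz Wx).
  have [_ bi] := bP' i; apply: etrans (bi (U h)) _.
  by rewrite UP model_eval_dot.
have /choice[V UV] := surU.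
have nrmU h : nrm (U h) = nrm h.
  apply/eqP; rewrite -(eqrXn2 (n := 2)) ?nrm_ge0 //; apply/eqP.
  by rewrite -!rdot_nrm /rdot isoU.
have VU h : V (U h) = h.
  apply/eqP; rewrite -subr_eq0; apply/eqP; apply: nrm_eq0.
  by rewrite -nrmU linear_B // UV subrr nrm0.
have lV : linear V.
  by move=> c x y; rewrite -[LHS]VU UV -{1}(UV x) -{1}(UV y) -lU VU.
exists (U \o T \o V); last first.
  exists U; split=> //; apply/funext => h /=; by rewrite VU.
split.
  apply/bounded_opP; have /bounded_opP[lT [c c0 Tc]] := bT.
  split; first by move=> d x y /=; rewrite lV lT lU.
  exists c => // y /=; rewrite nrmU; apply: le_trans (Tc _) _.
  by rewrite -nrmU UV.
move=> k z Oz; rewrite [LHS]evU // model_eval_shift //.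
by rewrite -{2}(UV k) evU.
Qed.

End Model.

(** * Moduli and Aluthge transforms of left-invertible operators *)

Section LeftInvertible.
Variable R : realType.
Local Notation C := R[i].
Local Open Scope complex_scope.

(** [S N = N S] because [S] commutes with [B = S ^ 2]. *)
Lemma sqrt_inverse (H : hilbertType R) (S B N : H -> H) : bounded_op S ->
  (forall x, S (S x) = B x) -> is_inverse B N -> is_inverse S (S \o N).
Proof.
move=> bS SS BN; have SSN x : S (S (N x)) = x by rewrite SS (is_inverseVK BN).
apply: is_inverseI => [|x|x] //=; first exact: bounded_comp (bounded_inverse BN).
by rewrite -[LHS](is_inverseK BN) -SS SSN SS (is_inverseK BN).
Qed.

Variables (H : hilbertType R) (T : H -> H).
Hypotheses (bT : bounded_op T) (liT : left_invertible T).

Let lT := bounded_linear bT.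
Let bTa := bounded_adjoint bT.
Local Notation "T ^a" := (adjoint T) (at level 2).

Lemma left_invertible_inj x : T x = 0 -> x = 0.
Proof.
case: liT => X [bX XT] Tx.
by rewrite -[x]/(id x) -XT /= Tx linear_0 //; exact: bounded_linear.
Qed.

(** Left invertibility bounds [T] from below. *)
Lemma coercive_sandwich (B : H -> H) : coercive B -> coercive (T^a \o B \o T).
Proof.
case: liT => X [/bounded_opP[lX [k k0 Xk]] XT] [c c0 Bc].
exists (c / k ^+ 2) => [|x]; first by rewrite divr_gt0 ?exprn_gt0.
have XTx : X (T x) = x := congr1 (@^~ x) XT.
have xT : nrm x <= k * nrm (T x) by rewrite -{1}XTx.
rewrite /= /rdot hdot_adjl // -/(rdot _ _); apply: le_trans (Bc _).
rewrite -mulrA ler_pM2l // mulrC ler_pdivrMr ?exprn_gt0 // mulrC -exprMn.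
by rewrite ler_pXn2r ?nnegrE ?mulr_ge0 ?nrm_ge0 ?(ltW k0).
Qed.

Lemma coercive_adjoint_self : coercive (T^a \o T).
Proof.
have cid : coercive (@id H) by exists 1 => // x; rewrite rdot_nrm mul1r.
exact: coercive_sandwich cid.
Qed.

Let bTT : bounded_op (T^a \o T). Proof. exact: bounded_comp. Qed.

Local Notation A := (op_abs T).

Lemma op_absP : positive_op A /\ forall x, A (A x) = T^a (T x).
Proof.
apply: op_sqrtP => //; last exact: coercive_adjoint_self.
by move=> x y; rewrite /rdot /= hdot_adjl // hdot_adjr.
Qed.

Let pA : positive_op A. Proof. by case: op_absP. Qed.
Let AA x : A (A x) = T^a (T x). Proof. by case: op_absP. Qed.
Let sA : symmetric_op A. Proof. exact: positive_symmetric. Qed.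
Let bA : bounded_op A. Proof. exact: positive_bounded. Qed.

Lemma op_abs_inverse : is_inverse A (op_inv A).
Proof.
apply: op_invP; have [N iN] := coercive_inverse bTT coercive_adjoint_self.
by exists (A \o N); exact: sqrt_inverse iN.
Qed.

Lemma coercive_op_abs : coercive A.
Proof. exact: positive_coercive op_abs_inverse. Qed.

Local Notation h := (op_sqrt A).
Local Notation hi := (op_inv (op_sqrt A)).

Lemma abs_halfP : positive_op h /\ forall x, h (h x) = A x.
Proof. exact: op_sqrtP coercive_op_abs. Qed.

Let ph : positive_op h. Proof. by case: abs_halfP. Qed.
Let hh x : h (h x) = A x. Proof. by case: abs_halfP. Qed.
Let bh : bounded_op h. Proof. exact: positive_bounded. Qed.

Lemma abs_half_inverse : is_inverse h hi.
Proof.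
by apply: op_invP; exists (h \o op_inv A); exact: sqrt_inverse op_abs_inverse.
Qed.

Let hK := is_inverseK abs_half_inverse.
Let hiK := is_inverseVK abs_half_inverse.
Let bhi := bounded_inverse abs_half_inverse.

Lemma abs_half_sym x y : hdot (h x) y = hdot x (h y).
Proof.
apply: hdot_symmetric; first exact: bounded_linear.
exact: positive_symmetric.
Qed.

(** As [|T|] is invertible, [T = U |T|] determines [U]. That some such [U] is a
    partial isometry follows from [|T| ^ 2 = T^a T]. *)
Lemma polar_isometryE x : polar_isometry T x = T (op_inv A x).
Proof.
have AiK := is_inverseVK op_abs_inverse.
have KAi := is_inverseK op_abs_inverse.
have bAi := bounded_inverse op_abs_inverse.
pose U y := T (op_inv A y).
have nU y : nrm (U y) = nrm y.
  apply/eqP; rewrite -(eqrXn2 (n := 2)) ?nrm_ge0 //; apply/eqP.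
  rewrite -!rdot_nrm /rdot /U hdot_adjr // -AA AiK -/(rdot _ _).
  by rewrite -sA AiK.
have kerU : op_ker U = op_ker T.
  apply/seteqP; split=> y.
    rewrite /op_ker /= => Uy; have -> : y = 0.
      by apply: nrm_eq0; rewrite -nU Uy nrm0.
    exact: linear_0.
  rewrite /op_ker /= => /left_invertible_inj ->.
  by apply: nrm_eq0; rewrite nU nrm0.
suff [_ TU _] : [/\ partial_isometry (polar_isometry T),
    T = polar_isometry T \o A & op_ker (polar_isometry T) = op_ker T].
  by rewrite -{1}[x]AiK -[LHS]/((polar_isometry T \o A) _) -TU.
apply: (@xgetI _ (fun=> 0) [set U | [/\ partial_isometry U, T = U \o A &
  op_ker U = op_ker T]] U); split=> //.
- split=> [|y _]; first exact: bounded_comp bAi.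
  by rewrite !nrmE nU.
- by apply/funext => y; rewrite /U /= KAi.
Qed.

(** The Aluthge transform is similar to [T], through [|T| ^ 1/2]. *)
Lemma aluthgeE : aluthge T = h \o T \o hi.
Proof.
apply/funext => x; rewrite /aluthge /= polar_isometryE.
have -> : h x = A (hi x) by rewrite -hh hiK.
by rewrite (is_inverseK op_abs_inverse).
Qed.

Lemma bounded_aluthge : bounded_op (aluthge T).
Proof. rewrite aluthgeE; exact: bounded_comp (bounded_comp bh bT) bhi. Qed.

(** The Shimorin left inverse of [T] for the inner product weighted by
    [A = |T|]. The similarity by [|T| ^ 1/2] turns that weighted inner product
    into the given one, hence this operator into the Shimorin left inverse of
    the Aluthge transform. *)
Definition weighted_left_inv : H -> H :=
  op_inv (T^a \o A \o T) \o T^a \o A.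

Local Notation G := weighted_left_inv.

Let iTAT : is_inverse (T^a \o A \o T) (op_inv (T^a \o A \o T)).
Proof.
apply: op_invP; apply: coercive_inverse.
  exact: bounded_comp (bounded_comp bTa bA) bT.
exact: coercive_sandwich coercive_op_abs.
Qed.

Lemma bounded_weighted_left_inv : bounded_op G.
Proof. exact: bounded_comp (bounded_comp (bounded_inverse iTAT) bTa) bA. Qed.

Lemma weighted_left_invK : cancel T G.
Proof. exact: is_inverseK iTAT. Qed.

(** [T G] is the projection onto the range of [T] that is orthogonal for the
    inner product weighted by [A]. *)
Lemma weighted_projection x : T^a (A (T (G x))) = T^a (A x).
Proof. exact: is_inverseVK iTAT _. Qed.

Definition aluthge_left_inv : H -> H := h \o G \o hi.

Lemma bounded_aluthge_left_inv : bounded_op aluthge_left_inv.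
Proof. exact: bounded_comp (bounded_comp bh bounded_weighted_left_inv) bhi. Qed.

Lemma aluthge_left_invK : cancel (aluthge T) aluthge_left_inv.
Proof.
by move=> x; rewrite aluthgeE /aluthge_left_inv /= hK weighted_left_invK hiK.
Qed.

Lemma hdot_aluthge x y : hdot (aluthge T x) y = hdot (hi x) (T^a (h y)).
Proof. by rewrite aluthgeE /= abs_half_sym hdot_adjr. Qed.

Lemma aluthge_range_ortho x :
  (hi @` op_ker T^a) x <-> forall y, hdot (aluthge T y) x = 0.
Proof.
split=> [[y Ty <-] z|xT]; first by rewrite hdot_aluthge hiK Ty hdot0r.
exists (h x); last exact: hK.
rewrite /op_ker /=; apply: hdotxx_eq0.
by rewrite -{1}[T^a _]hK -hdot_aluthge.
Qed.

Lemma aluthge_defect x :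
  (hi @` op_ker T^a) (x - aluthge T (aluthge_left_inv x)).
Proof.
apply/aluthge_range_ortho => y; rewrite hdot_aluthge aluthgeE /= hK.
have -> : x - h (T (G (hi x))) = h (hi x - T (G (hi x))).
  by rewrite (linear_B _ _ (bounded_linear bh)) hiK.
rewrite hh (linear_B _ _ (bounded_linear bA)) (linear_B _ _ (bounded_linear bTa)).
by rewrite weighted_projection subrr hdot0r.
Qed.

Lemma aluthge_pure : (forall x, (forall n, exists y, x = iter n T y) -> x = 0) ->
  forall x, (forall n, exists y, x = iter n (aluthge T) y) -> x = 0.
Proof.
move=> pT x xT; rewrite -[x]hiK (pT (hi x)) => [|n].
  exact: linear_0 (bounded_linear bh).
have [y ->] := xT n; exists (hi y).
by elim: n => [//|n IH] /=; rewrite {1}aluthgeE /= hK IH.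
Qed.

(** Both sides are left inverses of [T], so they agree on its range, and they
    agree on the line [ker T^a]; these two subspaces span [H]. *)
Lemma shimorin_rank_one (f0 : H) : hdot f0 f0 = 1 ->
  op_ker T^a = [set c *: f0 | c in [set: C]] ->
  forall x, shimorin_inv T x + hdot x f0 *:
    op_inv (T^a \o A \o T) (T^a (A f0)) = G x.
Proof.
move=> f01 kerT x; have iTT : is_inverse (T^a \o T) (op_inv (T^a \o T)).
  apply: op_invP; exact: coercive_inverse coercive_adjoint_self.
pose y := shimorin_inv T x.
have [c _ cE] : [set c *: f0 | c in [set: C]] (x - T y).
  rewrite -kerT /op_ker /= (linear_B _ _ (bounded_linear bTa)).
  by apply/eqP; rewrite subr_eq0; apply/eqP/esym/(is_inverseVK iTT).
have Tf0 : T^a f0 = 0.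
  have : op_ker T^a f0 by rewrite kerT; exists 1 => //; rewrite scale1r.
  by [].
have -> : hdot x f0 = c.
  have -> : x = c *: f0 + T y by rewrite cE subrK.
  by rewrite hdotDl hdotZl f01 mulr1 hdot_adjr // Tf0 hdot0r addr0.
rewrite -/y -[x in RHS](subrK (T y)) -cE.
rewrite (linear_D _ _ (bounded_linear bounded_weighted_left_inv)).
rewrite (linear_Z _ _ (bounded_linear bounded_weighted_left_inv)).
by rewrite weighted_left_invK addrC.
Qed.

End LeftInvertible.

(** * The shift on a space of analytic functions on the disc *)

Section Shift.
Variable R : realType.
Local Notation C := R[i].

(** A function in the range of every power of the shift has a zero of infinite
    order at the origin. *)
Lemma shift_pure (E : normedModType C) (H : hilbertType R)
    (ev : H -> C -> E) (M : H -> H) :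
  analytic_function_space unit_disc ev -> is_shift unit_disc ev M ->
  forall f, (forall n, exists g, f = iter n M g) -> f = 0.
Proof.
move=> [_ ev0 evA] [_ evM] f fM; apply: ev0.
have evMn n g z : unit_disc z -> ev (iter n M g) z = z ^+ n *: ev g z.
  move=> Dz; elim: n => [|n IH]; first by rewrite scale1r.
  by rewrite /= evM // IH scalerA exprS.
have D0 : unit_disc (0 : C) by rewrite unit_discE cabs0 ltr01.
have exp0 g : exists (c : nat -> E) (r : R), [/\ 0 < r,
    power_series_on c r (ev g) & forall z, cabs z < r -> unit_disc z].
  have [c [r [r0 cr]]] := analytic_expansion (evA g) D0.
  by exists c, r; split=> // z /cr; rewrite add0r => -[].
have [c [r [r0 cr rD]]] := exp0 f.
have c0 : forall n, c n = 0.
  apply: (power_series_flat r0 cr) => n e e0.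
  have [g fg] := fM n.+1; have [b [s [s0 bs sD]]] := exp0 g.
  have [k [p [k0 p0 kp]]] := taylor_remainder 0 s0 bs.
  have k1 : 0 < 1 + k by rewrite ltr_pwDl.
  pose d := Num.min (Num.min e s) (Num.min p (e / (1 + k))).
  have d0 : 0 < d by rewrite !lt_min e0 s0 p0 divr_gt0.
  pose t := d / 2.
  have t0 : 0 < t by rewrite divr_gt0.
  have td : t < d by rewrite /t; lra.
  have := td; rewrite !lt_min => /andP[/andP[te ts] /andP[tp tk]].
  have tE : cabs t%:C%C = t by rewrite cabs_real gtr0_norm.
  exists t%:C%C; split; [by rewrite fmorph_eq0 gt_eqF|by rewrite tE|].
  have Dt : unit_disc (t%:C%C) by apply: sD; rewrite tE.
  have tp' : cabs t%:C%C < p by rewrite tE.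
  have := kp _ tp'; rewrite big_ord0 subr0 expr0 mulr1 => gk.
  rewrite fg evMn // nrmZ cabsX tE exprSr -mulrA [e * _]mulrC.
  rewrite ler_wpM2l ?exprn_ge0 ?(ltW t0) //.
  apply: le_trans (ler_wpM2l (ltW t0) gk) _.
  have tke : t * (1 + k) < e by rewrite -ltr_pdivlMr.
  nra.
have fr z : cabs z < r -> ev f z = 0.
  by move=> zr; exact: power_series_0 cr zr c0.
by move=> z; exact: identity_theorem_disc (evA f) r0 fr z.
Qed.

End Shift.

Theorem theorem7p6 (R : realType) (k : R[i] -> R[i] -> R[i])
  (Hk : hilbertType R) (ev : Hk -> R[i] -> R[i]^o) (M : Hk -> Hk)
  (f : nat -> Hk)
  (k_analytic : analytic_kernel unit_disc k)
  (Hk_rkhs : is_rkhs unit_disc k ev)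
  (M_shift : is_shift unit_disc ev M)
  (polys_in_Hk : forall p : {poly R[i]},
     exists g : Hk, forall z, unit_disc z -> ev g z = p.[z])
  (f_poly : forall n, exists p : {poly R[i]},
     forall z, unit_disc z -> ev (f n) z = p.[z])
  (f_basis : orthonormal_basis f)
  (M_left_invertible : left_invertible M)
  (ker_adjM : op_ker (adjoint M) = [set c *: f 0%N | c in [set: R[i]]])
  (f_span : forall n, (1 <= n)%N ->
     lin_span [set g : Hk | exists2 m, (1 <= m)%N &
                          forall z, unit_disc z -> ev g z = z ^+ m] (f n)) :
  let absM := op_abs M in
  let F := fun g : Hk =>
    hdot g (f 0%N) *:
      op_inv (adjoint M \o absM \o M) (adjoint M (absM (f 0%N))) in
  let absM_half := op_sqrt absM in
  let L := absM_half \o (shimorin_inv M \+ F) \o op_inv absM_half in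
  let W := op_inv absM_half @` op_ker (adjoint M) in
  (* |z| < 1 / r(L), with 1 / 0 read as +oo *)
  let Omega := [set z : R[i] | complex.Re `|z| * spectral_radius L < 1] in
  let kt := fun z w : R[i] =>
    oproj W \o op_inv (fun x => x - z *: L x)
            \o op_inv (fun x => x - w^* *: adjoint L x) in
  [/\ analytic_op_kernel W Omega kt,
      exists (Ht : hilbertType R) (evt : Ht -> R[i] -> Hk),
        is_op_rkhs W Omega kt evt &
      forall (Ht : hilbertType R) (evt : Ht -> R[i] -> Hk),
        is_op_rkhs W Omega kt evt ->
        exists2 Mt : Ht -> Ht, is_shift Omega evt Mt &
          unitarily_equivalent (aluthge M) Mt].
Proof.
move=> absM F absM_half L W Omega kt.
have [bM _] := M_shift.
have pureM := shift_pure (proj1 Hk_rkhs) M_shift.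
have f01 : hdot (f 0%N) (f 0%N) = 1 by case: f_basis => ->.
have LE : L = aluthge_left_inv M.
  apply/funext => x; rewrite /L /aluthge_left_inv /=; congr (absM_half _).
  exact: shimorin_rank_one.
have bT := bounded_aluthge bM M_left_invertible.
have bL : bounded_op L by rewrite LE; exact: bounded_aluthge_left_inv.
have LT : cancel (aluthge M) L by rewrite LE; exact: aluthge_left_invK.
have WE x : W x <-> forall y, hdot (aluthge M y) x = 0.
  exact: aluthge_range_ortho.
have WTL x : W (x - aluthge M (L x)) by rewrite LE; exact: aluthge_defect.
have pureT := aluthge_pure bM M_left_invertible pureM.
split.
- exact: model_kernel_analytic bT bL WE WTL.
- by exists Hk, (model_eval L W); exact: model_rkhs bT bL WE WTL pureT.
- by move=> Ht evt; apply: (model_unitary bT bL LT WE WTL pureT).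
Qed.
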